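(* Let $\ell$ be a positive integer, let $f_1,\dots,f_k$ be $\mathbb{Q}$-linearly independent pseudo-polynomials, let $A=(a_{ij})$ be an arbitrary $\ell\times k$ matrix with real entries and let $N\in\mathbb{N}$. Then there is an exponent $\eta>0$ depending only on $\ell$ and on $f_1,\dots,f_k$ such that \[\min_{1\le n\le N}\max_{1\le i\le\ell}\Big\lVert\sum_{j=1}^k a_{ij}\lfloor f_j(n)\rfloor\Big\rVert\ll_{\ell,f_1,\dots,f_k}N^{-\eta},\] where the bound is uniform in $A$.
   Context: A pseudo-polynomial is a function $f(x)=\alpha_1x^{\theta_1}+\cdots+\alpha_dx^{\theta_d}$ where $\alpha_1,\dots,\alpha_d,\theta_1,\dots,\theta_d$ are positive reals with $1\le\theta_1<\cdots<\theta_d$ and at least one $\theta_j\notin\mathbb{Z}$. $\lVert x\rVert$ denotes the distance from $x$ to the nearest integer, and $\lfloor\cdot\rfloor$ the floor function. *)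

(* Defs.v *)
From HB Require Import structures.
From mathcomp Require Import all_boot all_order all_algebra.
From mathcomp Require Import all_classical all_reals all_analysis.
Set Implicit Arguments. Unset Strict Implicit. Unset Printing Implicit Defensive.
Import Order.TTheory GRing.Theory Num.Theory.
Local Open Scope ring_scope.

Definition dist_int {R : realType} (x : R) : R :=
  Num.min (x - (Num.floor x)%:~R) ((Num.floor x + 1)%:~R - x).

Definition pseudo_poly {R : realType} (f : R -> R) : Prop :=
  exists (d : nat) (alpha theta : 'I_d -> R),
    (forall j, 0 < alpha j) /\
    (forall j, 1 <= theta j) /\
    (forall i j : 'I_d, (i < j)%N -> theta i < theta j) /\
    (exists j, ~ exists z : int, theta j = z%:~R) /\
    (forall x : R, 0 < x -> f x = \sum_(j < d) alpha j * powR x (theta j)).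

Definition Q_lin_indep {R : realType} (k : nat) (f : 'I_k -> R -> R) : Prop :=
  forall c : 'I_k -> rat,
    (forall x : R, 0 < x -> \sum_(j < k) ratr (c j) * f j x = 0) ->
    forall j, c j = 0.

(* Main.v *)
Require Import Defs.
From HB Require Import structures.
From mathcomp Require Import all_boot all_order all_algebra.
From mathcomp Require Import all_classical all_reals all_analysis.
From mathcomp Require Import zify ring lra.
Set Implicit Arguments. Unset Strict Implicit. Unset Printing Implicit Defensive.
Import Order.TTheory GRing.Theory Num.Theory.
Import numFieldNormedType.Exports.
Local Open Scope ring_scope.

(** Write every [f j] as a polynomial plus a combination of non-integral powers
[n `^ th], and reduce [A] modulo 1.  If [f j n] exceeds an integer by at most
[O(1/K)], then [\sum_j A i j * floor (f j n)] is within [O(1/K)] of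
[\sum_j A i j * f j n], so floors disappear once the [f j] themselves are added to
the list of forms to be made small modulo 1.  To land just above an integer rather
than just below it, each [n `^ th] is replaced by [n `^ th - tau] with
[tau ~ 1/K].  Only absolute values of exponential sums matter, so this shift is free.

The resulting forms are treated by induction on their number.  Let [n = M + m] run
over a short interval [m < L], where [L = W ^ t1] and [M = W ^ t1.+1].  If no such [n]
works, a Fourier argument with the kernel [cos (pi x) ^+ (2 r)] produces a small
integer combination [h] of the forms whose exponential sum is large.  On the interval
this combination is a polynomial up to a negligible error (Taylor), so Weyl's method
bounds its Taylor coefficients modulo 1.  Those of large order only see the
non-integral powers, and a Vandermonde-type elimination shows that their coefficients
are tiny; those of small order then give rational approximations, with common
denominator [q], to the integral part.  Hence along [n = q * `|h i0| * m'] the [i0]-th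
form is controlled by the others.

All losses are powers [K ^ E] of a parameter [K >= 2], with [E] depending only on
the shape of the forms. *)

(** * Distance to the integers and pigeonhole *)

(** The bound [dist_int x <= eps] with the integer as a witness: witnesses add, so sums and integer
    multiples compose. [dist_int] returns only through [dist_int_le]. *)
Definition nearint {R : realType} (eps x : R) : Prop :=
  exists z : int, `|x - z%:~R| <= eps.

Section NearInt.
Variable R : realType.
Implicit Types (x y eps : R) (z : int).

Lemma nearint_le eps eps' x : eps <= eps' -> nearint eps x -> nearint eps' x.
Proof. by move=> le [z Hz]; exists z; apply: le_trans le. Qed.

Lemma nearint_small eps x : `|x| <= eps -> nearint eps x.
Proof. by move=> Hx; exists 0; rewrite subr0. Qed.

Lemma nearintD e1 e2 x y : nearint e1 x -> nearint e2 y -> nearint (e1 + e2) (x + y).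
Proof.
move=> [u Hu] [v Hv]; exists (u + v).
rewrite intrD opprD addrACA; apply: (le_trans (ler_normD _ _)); exact: lerD.
Qed.

Lemma nearintN eps x : nearint eps x -> nearint eps (- x).
Proof. by move=> [u Hu]; exists (- u); rewrite intrN -opprD normrN. Qed.

Lemma nearintB e1 e2 x y : nearint e1 x -> nearint e2 y -> nearint (e1 + e2) (x - y).
Proof. by move=> H1 H2; apply: nearintD => //; apply: nearintN. Qed.

Lemma nearintMz z eps x : nearint eps x -> nearint (`|z|%:~R * eps) (z%:~R * x).
Proof.
move=> [u Hu]; exists (z * u).
by rewrite intrM -mulrBr normrM -intr_norm ler_wpM2l.
Qed.

Lemma nearintMn (n : nat) eps x : nearint eps x -> nearint (n%:R * eps) (n%:R * x).
Proof. by move=> H; have := nearintMz n%:Z H. Qed.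

Lemma nearint_sum (I : Type) (r : seq I) (P : pred I) (e F : I -> R) :
  (forall i, P i -> nearint (e i) (F i)) ->
  nearint (\sum_(i <- r | P i) e i) (\sum_(i <- r | P i) F i).
Proof.
move=> H; apply: (big_ind2 (fun a b => nearint a b)) => //.
  by apply: nearint_small; rewrite normr0.
by move=> *; apply: nearintD.
Qed.

Lemma nearint_half x : exists z, `|x - z%:~R| <= 2^-1.
Proof.
have [l u] := andP (floor_itv x).
rewrite intrD in u.
case: (lerP (x - (Num.floor x)%:~R) 2^-1) => H.
  by exists (Num.floor x); rewrite ger0_norm // subr_ge0.
exists (Num.floor x + 1); rewrite intrD ler0_norm; first by lra.
by lra.
Qed.

Lemma nearint1 eps x : 1 <= eps -> nearint eps x.
Proof. by move=> H; have [z Hz] := nearint_half x; exists z; lra. Qed.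

Lemma intr_norm_lt1 z : `|z%:~R : R| < 1 -> z = 0.
Proof. by rewrite -intr_norm -[1]/(1%:~R) ltr_int; lia. Qed.

(** No wrap-around: the approximating integer has absolute value below 1, so it is 0. This turns a
    bound modulo 1 into a bound on the real number itself. *)
Lemma nearint_norm_le eps x : nearint eps x -> `|x| + eps < 1 -> `|x| <= eps.
Proof.
move=> [z Hz] H.
suff z0 : z = 0 by move: Hz; rewrite z0 subr0.
apply: intr_norm_lt1; apply: le_lt_trans H.
have -> : z%:~R = x - (x - z%:~R) :> R by rewrite subKr.
by apply: (le_trans (ler_normB _ _)); rewrite lerD2l.
Qed.

End NearInt.

Section Pigeonhole.

Lemma count_fibers (T : eqType) (s : seq T) (f : T -> nat) (n : nat) :
  {in s, forall x, f x < n}%N ->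
  (\sum_(c < n) count (fun x => f x == c :> nat) s = size s)%N.
Proof.
elim: s => [|x s IH] H /=; first by rewrite big1.
rewrite big_split /= IH; last by move=> y ys; apply: H; rewrite inE ys orbT.
have fx : (f x < n)%N by apply: H; rewrite mem_head.
rewrite (bigD1 (Ordinal fx)) //= eqxx big1 // => c /eqP neq.
by case: eqP => // E; case: neq; apply/val_inj.
Qed.

Lemma pigeonhole (T : eqType) (s : seq T) (f : T -> nat) (n : nat) :
  (0 < n)%N -> {in s, forall x, f x < n}%N ->
  exists2 c, (c < n)%N & (size s <= n * size [seq x <- s | f x == c])%N.
Proof.
move=> n0 H; apply: contrapT => noc.
have lt (c : 'I_n) : (n * count (fun x => f x == c :> nat) s < size s)%N.
  rewrite ltnNge; apply/negP => le; apply: noc; exists c => //.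
  by rewrite size_filter.
have : (\sum_(c < n) (n * count (fun x => f x == c :> nat) s).+1 <= \sum_(c < n) size s)%N.
  by apply: leq_sum => c _; apply: lt.
rewrite sum_nat_const card_ord.
under eq_bigr do rewrite -addn1.
rewrite big_split /= -big_distrr /= count_fibers // sum_nat_const card_ord; lia.
Qed.

Lemma spread (s : seq nat) (k : nat) : uniq s -> size s = k.+1 ->
  exists x y, [/\ x \in s, y \in s & (x + k <= y)%N].
Proof.
move=> us ss.
have ex : exists x, x \in s by case: s ss {us} => // x s _; exists x; rewrite mem_head.
have [m ms min] := ex_minnP ex.
apply: contrapT => no.
have sub : {subset s <= iota m k}.
  move=> y ys; rewrite mem_iota min //= ltnNge; apply/negP => le.
  by apply: no; exists m, y.
have := uniq_leq_size us sub; rewrite size_iota ss; lia.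
Qed.

End Pigeonhole.

(** * Vinogradov's lemma on many multiples near integers *)

Section Vinogradov.
Variable R : realType.

(** Among the cells given by a block of length [H] and a residue class modulo [q], one contains many
    elements of [s]. Two elements far apart in it differ by [u * q], so [u * theta] is within
    [2 * eps] of an integer; its size is at most 1/4, so that integer is 0 and [theta] is bounded
    directly. *)
Lemma vinogradov_block (K L q H : nat) (s : seq nat) (eps beta theta : R) (z : int) :
  (0 < K)%N -> uniq s -> {in s, forall h, (1 <= h <= L)%N} ->
  {in s, forall h : nat, nearint eps (h%:R * beta)} -> (L <= K * size s)%N ->
  4 * eps < 1 -> (1 <= q <= 2 * K)%N -> q%:R * beta = z%:~R + theta ->
  (8 * K ^ 2 <= H <= L)%N -> 4 * (H%:R * `|theta|) <= 1 ->
  H%:R * `|theta| <= 32 * K%:R ^+ 3 * eps.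
Proof.
move=> K0 us rs ns Ls e4 /andP[q1 qK] qb /andP[HK HL] Hth.
have H0 : (0 < H)%N by apply: leq_trans HK; rewrite muln_gt0 expn_gt0 K0.
(* Block number and residue are packed into one natural number; [exy] unpacks them. *)
have [] := @pigeonhole _ s (fun h => (h %/ H) * q + h %% q)%N ((L %/ H).+1 * q).
- by rewrite muln_gt0 q1.
- move=> h /rs /andP[_ hL].
  have : (h %/ H <= L %/ H)%N by apply: leq_div2r.
  have : (h %% q < q)%N by rewrite ltn_mod.
  by nia.
move=> c _; set s' := [seq x <- s | _]; set F := size s' => HF.
have HF4 : (H <= 4 * K ^ 2 * F)%N.
  have : ((L %/ H).+1 * H <= 2 * L)%N by have := leq_trunc_div L H; move: HL; clear; nia.
  have L0 : (0 < L)%N by apply: leq_trans HL.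
  move=> h1; rewrite -(leq_pmul2l L0).
  apply: (leq_trans (n := (K * (((L %/ H).+1 * q) * F)) * H)%N).
    rewrite leq_pmul2r //; apply: (leq_trans Ls); exact: leq_mul.
  rewrite (_ : _ * H = (K * q * F) * ((L %/ H).+1 * H))%N; last by ring.
  apply: (leq_trans (n := (K * (2 * K) * F) * (2 * L))%N).
    by apply: leq_mul => //; rewrite leq_mul2r leq_mul2l qK !orbT.
  by rewrite eq_leq //; ring.
have F2 : (2 <= F)%N by rewrite leqNgt; apply/negP => Flt; move: K0 HK HF4 Flt; clear; nia.
have us' : uniq s' by apply: filter_uniq.
have [x [y [xs ys xy]]] := @spread s' F.-1 us' ltac:(by rewrite prednK // ltnW).
move: xs ys; rewrite !mem_filter => /andP[/eqP ex xs] /andP[/eqP ey ys].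
have exy : (x %/ H = y %/ H)%N /\ (x %% q = y %% q)%N.
  have lx : (x %% q < q)%N by rewrite ltn_mod.
  have ly : (y %% q < q)%N by rewrite ltn_mod.
  have E : (x %/ H * q + x %% q = y %/ H * q + y %% q)%N by rewrite ex ey.
  have E1 := congr1 (fun t => t %/ q)%N E; have E2 := congr1 (fun t => t %% q)%N E.
  move: E1 E2 => /=.
  by rewrite !divnMDl // !modnMDl !(divn_small lx) !(divn_small ly) !addn0 !modn_mod.
case: exy => eH eq'.
have lxy : (x <= y)%N by apply: leq_trans xy; apply: leq_addr.
have dvd : (q %| y - x)%N by rewrite -eqn_mod_dvd // eq'.
have dH : (y - x < H)%N.
  have := divn_eq x H; have := divn_eq y H; rewrite eH.
  have : (y %% H < H)%N by rewrite ltn_mod.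
  by clear; lia.
move/dvdnP: dvd => [u du].
have Hu : nearint (eps + eps) (u%:R * theta).
  have : nearint (eps + eps) ((y%:R - x%:R) * beta).
    by rewrite mulrBl; apply: nearintB; apply: ns.
  rewrite -natrB // du natrM -mulrA qb mulrDr => -[w Hw].
  by exists (w - u%:Z * z); move: Hw; congr (`|_| <= _); rewrite intrB intrM; ring.
have th0 : 0 <= `|theta| by [].
have Hd : (y - x)%:R * `|theta| <= H%:R * `|theta|.
  by rewrite ler_wpM2r // ler_nat ltnW.
have Hnu : `|u%:R * theta| <= (y - x)%:R * `|theta|.
  by rewrite normrM normr_nat ler_wpM2r // ler_nat du leq_pmulr.
have ut : `|u%:R * theta| <= eps + eps.
  by apply: nearint_norm_le Hu _; lra.
have dt : (y - x)%:R * `|theta| <= q%:R * (eps + eps).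
  by rewrite du natrM (mulrC u%:R) -mulrA -(normr_nat _ u) -normrM ler_wpM2l.
have H8 : (H <= 8 * K ^ 2 * (y - x))%N.
  have h2 : (F <= 2 * (y - x))%N by move: xy F2; clear; lia.
  apply: (leq_trans HF4); apply: (leq_trans (n := (4 * K ^ 2 * (2 * (y - x)))%N)).
    by rewrite leq_mul2l h2 orbT.
  by rewrite eq_leq //; ring.
have e0 : 0 <= eps by have := normr_ge0 (u%:R * theta); lra.
apply: (le_trans (y := (8 * K ^ 2 * (y - x))%:R * `|theta|)).
  by rewrite ler_wpM2r // ler_nat.
rewrite natrM -mulrA; apply: (le_trans (y := (8 * K ^ 2)%:R * (q%:R * (eps + eps)))).
  by rewrite ler_wpM2l.
apply: (le_trans (y := (8 * K ^ 2)%:R * ((2 * K)%:R * (eps + eps)))).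
  by rewrite ler_wpM2l // ler_wpM2r ?ler_nat //; lra.
by rewrite !natrM le_eqVlt; apply/orP; left; apply/eqP; ring.
Qed.

(** Two elements of [s] in one window of length [2 * K] differ by some [q], and [q * beta] is within
    [2 * eps] of an integer. [vinogradov_block] at [H = L] improves this by a factor of order [L],
    provided [4 * L * |theta| <= 1]; the other case is contradictory. *)
Lemma vinogradov (K L : nat) (s : seq nat) (eps beta : R) :
  (0 < K)%N -> uniq s -> {in s, forall h, (1 <= h <= L)%N} ->
  {in s, forall h : nat, nearint eps (h%:R * beta)} -> (L <= K * size s)%N ->
  (8 * K ^ 2 <= L)%N -> 512 * K%:R ^+ 3 * eps < 1 ->
  exists q, (1 <= q <= 2 * K)%N /\ nearint (32 * K%:R ^+ 3 * eps / L%:R) (q%:R * beta).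
Proof.
move=> K0 us rs ns Ls LK eK.
have K1r : 1 <= K%:R ^+ 3 :> R by rewrite -natrX ler1n expn_gt0 K0.
have L0 : (0 < L)%N by apply: leq_trans LK; rewrite muln_gt0 expn_gt0 K0.
have s0 : (0 < size s)%N by move: (leq_trans L0 Ls); rewrite muln_gt0 K0.
have e0 : 0 <= eps.
  case: s s0 ns {us rs Ls} => // h s _ /(_ h (mem_head _ _)) [z Hz].
  exact: le_trans Hz.
have e4 : 512 * eps < 1.
  have : 0 <= (K%:R ^+ 3 - 1) * eps by rewrite mulr_ge0 // subr_ge0.
  by lra.
have [] := @pigeonhole _ s (fun h => h %/ (2 * K))%N (L %/ (2 * K)).+1 => //.
  by move=> h /rs /andP[_ hL]; rewrite ltnS leq_div2r.
move=> c _; set s' := [seq x <- s | _]; set F := size s' => HF.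
have F2 : (1 < F)%N.
  rewrite ltnNge; apply/negP => F1.
  have h1 : (L %/ (2 * K) * (2 * K) <= L)%N by apply: leq_trunc_div.
  have h2 : (size s <= (L %/ (2 * K)).+1)%N.
    by apply: (leq_trans HF); rewrite -[X in (_ <= X)%N]muln1 leq_mul2l F1 orbT.
  have h3 : (L <= K * (L %/ (2 * K)).+1)%N by apply: (leq_trans Ls); rewrite leq_mul2l h2 orbT.
  by move: K0 LK h1 h3; clear; move: (L %/ _)%N => t; nia.
have us' : uniq s' by apply: filter_uniq.
have [x [y [xs ys xy]]] := @spread s' F.-1 us' ltac:(by rewrite prednK // ltnW).
move: xs ys; rewrite !mem_filter => /andP[/eqP ex xs] /andP[/eqP ey ys].
have K2 : (0 < 2 * K)%N by rewrite muln_gt0.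
have [q1 qK] : (1 <= y - x)%N /\ (y - x <= 2 * K)%N.
  have := divn_eq x (2 * K); have := divn_eq y (2 * K); rewrite ex ey.
  by have := ltn_pmod y K2; have := ltn_pmod x K2; move: F2 xy; clear; lia.
exists (y - x)%N; split; first by rewrite q1.
have lxy : (x <= y)%N by apply: leq_trans xy; apply: leq_addr.
have : nearint (eps + eps) ((y - x)%:R * beta).
  by rewrite natrB // mulrBl; apply: nearintB; apply: ns.
move=> [z Hz]; exists z; move: Hz.
set theta := _ - z%:~R => Hz.
have qb : (y - x)%:R * beta = z%:~R + theta by rewrite /theta addrC subrK.
have L0r : 0 < L%:R :> R by rewrite ltr0n.
have e40 : 4 * eps < 1 by lra.
have qK' : (1 <= y - x <= 2 * K)%N by rewrite q1.
have blk H := @vinogradov_block K L (y - x)%N H s eps beta theta z K0 us rs ns Ls e40 qK' qb.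
case: (lerP (4 * (L%:R * `|theta|)) 1) => Lt.
  by rewrite ler_pdivlMr // mulrC; apply: blk; rewrite // LK leqnn.
exfalso.
have t0 : 0 < `|theta|.
  rewrite normr_gt0; apply/eqP => t0; move: Lt; rewrite t0 normr0; lra.
(* For this [H] the product [H * |theta|] lies between 1/8 and 1/4, while [vinogradov_block] bounds
   it by [32 * K ^ 3 * eps < 1/16]. *)
pose H := Num.truncn ((4 * `|theta|)^-1).
have [Hl Hu] : H%:R <= (4 * `|theta|)^-1 /\ (4 * `|theta|)^-1 < H.+1%:R.
  have nn : 0 <= (4 * `|theta|)^-1 by rewrite invr_ge0; lra.
  by have /andP[] := truncn_itv nn.
have t40 : 0 < 4 * `|theta| by lra.
move: Hl Hu; rewrite -[X in _ <= X]mul1r -[X in X < _]mul1r ler_pdivlMr // ltr_pdivrMr //.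
rewrite -natr1 => Hl Hu.
have e0' : 0 < eps by lra.
have Hbig : (64 * K ^ 3 <= H)%N.
  rewrite -ltnS -(ltr_nat R) natrM natrX -natr1.
  rewrite -(ltr_pM2r (_ : 0 < 8 * eps)); last by lra.
  apply: (le_lt_trans (y := 1)); first by move: eK; lra.
  apply: (lt_le_trans Hu); apply: ler_wpM2l; last by lra.
  by have := ler0n R H; lra.
have HK : (8 * K ^ 2 <= H)%N.
  apply: leq_trans Hbig; rewrite (expnS K 2).
  by move: K0 (expn_gt0 K 2); clear; nia.
have HL : (H <= L)%N.
  have h : H%:R * (4 * `|theta|) <= L%:R * (4 * `|theta|) by lra.
  by move: h; rewrite ler_pM2r // ler_nat.
have := blk H ltac:(by rewrite HK) ltac:(lra).
have H1 : 1 <= H%:R :> R by rewrite ler1n; apply: leq_trans HK; rewrite muln_gt0 expn_gt0 K0.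
have : `|theta| <= H%:R * `|theta| by rewrite ler_peMl // ltW.
lra.
Qed.
End Vinogradov.

(** * Cosine sums and Weyl differencing *)

Section Trig.
Variable R : realType.
Implicit Types (x y : R) (z : int).

Lemma cos_lipschitz x y : `|cos x - cos y| <= `|x - y|.
Proof.
wlog le : x y / y <= x.
  move=> H; case/orP: (le_total y x) => [/H//|/H]; by rewrite distrC [X in _ <= X]distrC.
have dv (t : R) : t \in `]y, x[%R -> is_derive t 1 (cos : R -> R) (- sin t).
  by move=> _; apply: is_derive_cos.
have [|c _ ->] := MVT_segment le dv.
  by apply: continuous_subspaceT; exact: continuous_cos.
by rewrite normrM normrN ler_piMl // sin_max.
Qed.

Lemma sin_mvt (t : R) : 0 <= t -> exists2 c, 0 <= c <= t & sin t = cos c * t.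
Proof.
move=> t0.
have dv (u : R) : u \in `]0, t[%R -> is_derive u 1 (sin : R -> R) (cos u).
  by move=> _; apply: is_derive_sin.
have [|c ci] := MVT_segment t0 dv.
  by apply: continuous_subspaceT; exact: continuous_sin.
by rewrite sin0 !subr0 => E; exists c.
Qed.

(** A weak Jordan inequality by halving the angle: with [t = pi * y / 2], write
    [sin (2 * t) = 2 * cos t * sin t] and [sin t = cos c * t]; both cosines are at least
    [cos (pi / 4)], whose square is 1/2. *)
Lemma norm_le_sinpi y : `|y| <= 2^-1 -> `|y| <= `|sin (pi * y)|.
Proof.
wlog y0 : y / 0 <= y.
  move=> H; case/orP: (le_total 0 y) => [/H//|yneg] yh.
  by have := H (- y); rewrite oppr_ge0 mulrN sinN !normrN; apply.
rewrite ger0_norm // => yh.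
have p2 := pi_ge2 R.
set t : R := pi * y / 2.
have t0 : 0 <= t by rewrite /t divr_ge0 // mulr_ge0 // pi_ge0.
have t4 : t <= pi / 4.
  by rewrite /t -mulrA ler_wpM2l ?pi_ge0 //; lra.
have -> : pi * y = t *+ 2 by rewrite /t -[RHS]mulr_natr divfK.
have [c /andP[c0 ct] Et] := sin_mvt t0.
have c4 : cos (pi / 4 : R) ^+ 2 = 2^-1.
  have := cos_mulr2n (pi / 4 : R).
  rewrite (_ : pi / 4 *+ 2 = pi / 2 :> R); last by rewrite mulr2n; lra.
  by rewrite cos_pihalf mulr2n; lra.
have c4p : 0 <= cos (pi / 4 : R).
  by apply: cos_ge0_pihalf; have := pi_ge2 R; lra.
have mono u : 0 <= u <= pi / 4 -> cos (pi / 4) <= cos u :> R.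
  move=> /andP[u0 u4]; case: (ltgtP u (pi / 4)) u4 => // [lt _|-> //].
  by rewrite ltW // ltr_cos // in_itv /=; have := pi_ge2 R; lra.
have m1 : cos (pi / 4) <= cos c by apply: mono; rewrite c0 (le_trans ct).
have m2 : cos (pi / 4) <= cos t by apply: mono; rewrite t0.
have mm : 2^-1 <= cos t * cos c by rewrite -c4 expr2 ler_pM.
rewrite sin_mulr2n Et ger0_norm.
  rewrite mulrA mulr2n; have : 2^-1 * t <= cos t * cos c * t by rewrite ler_wpM2r.
  have : 2 * y <= pi * y by rewrite ler_wpM2r.
  by rewrite /t; lra.
rewrite mulrA mulr2n; have : 0 <= cos t * cos c * t by rewrite mulr_ge0 //; lra.
lra.
Qed.

Lemma norm_sinDpiz x z : `|sin (x + pi * z%:~R)| = `|sin x|.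
Proof.
have nat_case (u : R) (n : nat) : `|sin (u + pi * n%:R)| = `|sin u|.
  elim: n => [|n IH]; first by rewrite mulr0 addr0.
  by rewrite -natr1 mulrDr mulr1 addrA sinDpi normrN IH.
case: z => n; first exact: nat_case.
rewrite NegzE intrN -(nat_case _ n.+1); congr (`|sin _|).
rewrite -pmulrn; ring.
Qed.

Lemma nearint_sinpi x : nearint `|sin (pi * x)| x.
Proof.
have [z Hz] := nearint_half x; exists z.
apply: (le_trans (norm_le_sinpi Hz)).
rewrite le_eqVlt; apply/orP; left; apply/eqP.
by rewrite -(norm_sinDpiz _ z); congr (`|sin _|); ring.
Qed.

Lemma cos2piDz x z : cos (2 * pi * (x + z%:~R)) = cos (2 * pi * x).
Proof.
have nat_case (u : R) (n : nat) : cos (2 * pi * (u + n%:R)) = cos (2 * pi * u).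
  have E : 2 * pi * n%:R = pi *+ 2 *+ n :> R by rewrite -[RHS]mulr_natr mulr_natl.
  by rewrite mulrDr E periodicn //; exact: cosD2pi.
case: z => n; first exact: nat_case.
rewrite NegzE intrN -(nat_case (x - n.+1%:~R) n.+1); congr (cos _).
rewrite -pmulrn; ring.
Qed.

End Trig.

Section CosSums.
Variable R : realType.
Implicit Types (phi : nat -> R).

(** The real part of an exponential sum with phase [phi]. The detecting kernel is even, so real
    parts suffice; the sine sum occurs only inside [csum_sqr_le]. *)
Definition csum phi (n : nat) : R := \sum_(x < n) cos (2 * pi * phi x).

Lemma norm_csum_le phi n : `|csum phi n| <= n%:R.
Proof.
apply: (le_trans (ler_norm_sum _ _ _)).
apply: (le_trans (ler_sum _ (fun i _ => cos_max _))).
by rewrite sumr_const card_ord.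
Qed.

Lemma csum_dist phi psi n (e : R) :
  (forall x, (x < n)%N -> `|cos (2 * pi * phi x) - cos (2 * pi * psi x)| <= e) ->
  `|csum phi n - csum psi n| <= n%:R * e.
Proof.
move=> H; rewrite /csum -sumrB; apply: (le_trans (ler_norm_sum _ _ _)).
have -> : n%:R * e = \sum_(x < n) e by rewrite sumr_const card_ord mulr_natl.
by apply: ler_sum => i _; apply: H.
Qed.

(** Multiplication by [2 * sin (pi * g)] makes the cosines telescope to a difference of two
    sines. *)
Lemma geometric_csum (g c : R) n :
  `|csum (fun x => g * x%:R + c) n| * `|sin (pi * g)| <= 1.
Proof.
have -> : `|csum (fun x => g * x%:R + c) n| * `|sin (pi * g)| =
   2^-1 * `|sin (2 * pi * (g * n%:R + c) - pi * g) - sin (2 * pi * c - pi * g)|.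
  rewrite -normrM -[X in X * `|_|](ger0_norm (_ : 0 <= 2^-1)) ?invr_ge0 // -normrM.
  congr (`|_|); elim: n => [|n IH].
    by rewrite /csum big_ord0 mul0r mulr0 add0r subrr mulr0.
  rewrite /csum big_ord_recr /= mulrDl -/(csum _ n) IH -[n.+1%:R]natr1.
  have -> : 2 * pi * (g * (n%:R + 1) + c) - pi * g =
    2 * pi * (g * n%:R + c) + pi * g by ring.
  by rewrite !(sinD (2 * pi * (g * n%:R + c))) cosN sinN; field.
have := sin_max (2 * pi * (g * n%:R + c) - pi * g).
have := sin_max (2 * pi * c - pi * g).
have := ler_normB (sin (2 * pi * (g * n%:R + c) - pi * g)) (sin (2 * pi * c - pi * g)).
lra.
Qed.

Definition shift_diff phi (h x : nat) : R := phi (x + h)%N - phi x.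

(** Adding the square of the sine sum gives the squared modulus of the complex sum, which equals the
    right-hand side: the diagonal contributes [n], and the pairs at distance [h] twice the sum with
    phase [shift_diff phi h]. *)
Lemma csum_sqr_le phi n : (csum phi n) ^+ 2 <=
  n%:R + 2 * \sum_(i < n) csum (shift_diff phi i.+1) (n - i.+1).
Proof.
pose S m : R := \sum_(x < m) sin (2 * pi * phi x).
apply: (le_trans (y := csum phi n ^+ 2 + S n ^+ 2)); first by rewrite lerDl sqr_ge0.
rewrite le_eqVlt; apply/orP; left; apply/eqP.
elim: n => [|n IH].
  by rewrite /csum /S !big_ord0; ring.
rewrite /csum /S !big_ord_recr /= -/(csum phi n) -/(S n) subnn big_ord0 addr0.
have -> : \sum_(i < n) csum (shift_diff phi i.+1) (n.+1 - i.+1) =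
  \sum_(i < n) csum (shift_diff phi i.+1) (n - i.+1) +
  \sum_(i < n) cos (2 * pi * (phi n - phi i)).
  rewrite [X in _ = _ + X](reindex_inj rev_ord_inj) -big_split /=.
  apply: eq_bigr => i _; rewrite subSS -(subnSK (ltn_ord i)) /csum big_ord_recr /=.
  by rewrite /shift_diff subnK.
have -> : \sum_(i < n) cos (2 * pi * (phi n - phi i)) =
  cos (2 * pi * phi n) * csum phi n + sin (2 * pi * phi n) * S n.
  rewrite /csum /S !mulr_sumr -big_split /=; apply: eq_bigr => i _.
  by rewrite mulrBr cosB.
have E : cos (2 * pi * phi n) ^+ 2 + sin (2 * pi * phi n) ^+ 2 = 1 by apply: cos2Dsin2.
move: IH E; rewrite -[n.+1%:R]natr1.
move: (csum phi n) (S n) (cos _) (sin _) (\sum_(i < n) _) => C s c d T IH E.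
have -> : n%:R = C ^+ 2 + s ^+ 2 - 2 * T by rewrite IH; ring.
by lra.
Qed.

(** After squaring, the diagonal accounts for at most half of the total because [2 * K ^ 2 <= L],
    and the shifts with a small differenced sum for at most a quarter. The remaining shifts
    contribute at most [L] each, so there are many. *)
Lemma weyl_step phi (K L n : nat) :
  (0 < K)%N -> (0 < L)%N -> (n <= L)%N -> (2 * K ^ 2 <= L)%N ->
  L%:R <= K%:R * `|csum phi n| ->
  exists s : seq nat, [/\ uniq s, {in s, forall h, (1 <= h <= L)%N},
    (L <= 8 * K ^ 2 * size s)%N &
    {in s, forall h, (h <= n)%N /\
      L%:R <= (8 * K ^ 2)%:R * `|csum (shift_diff phi h) (n - h)|}].
Proof.
move=> K0 L0 nL KL big.
pose c h := `|csum (shift_diff phi h) (n - h)|.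
pose P h := L%:R <= (8 * K ^ 2)%:R * c h.
have cL h : c h <= L%:R.
  apply: (le_trans (norm_csum_le _ _)); rewrite ler_nat.
  by rewrite (leq_trans _ nL) // leq_subr.
exists [seq h <- index_iota 1 n.+1 | P h]; split.
- by rewrite filter_uniq // iota_uniq.
- by move=> h; rewrite mem_filter mem_index_iota => /andP[_]; move: nL; clear; lia.
- have B0 : 0 < (8 * K ^ 2)%:R :> R by rewrite ltr0n muln_gt0 expn_gt0 K0.
  have L0r : 0 < L%:R :> R by rewrite ltr0n.
  have sumle : \sum_(1 <= h < n.+1) c h <=
      (size [seq h <- index_iota 1 n.+1 | P h])%:R * L%:R + L%:R * (L%:R / (8 * K ^ 2)%:R).
    rewrite (bigID P) /=; apply: lerD.
      rewrite -big_filter mulr_natl; apply: (le_trans (ler_sum _ (fun h _ => cL h))).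
      by rewrite big_const_seq count_predT iter_addr_0.
    apply: (le_trans (y := \sum_(1 <= h < n.+1) (L%:R / (8 * K ^ 2)%:R))); last first.
      rewrite sumr_const_nat subSS subn0 -[X in X <= _]mulr_natl.
      by rewrite ler_wpM2r ?divr_ge0 ?ler0n // ler_nat.
    rewrite [X in _ <= X](bigID P) /= -[X in X <= _]add0r; apply: lerD.
      by apply: sumr_ge0 => h _; rewrite divr_ge0 ?ler0n.
    apply: ler_sum => h; rewrite /P -ltNge => lt.
    by rewrite ler_pdivlMr // mulrC ltW.
  have sqle : (csum phi n) ^+ 2 <= n%:R + 2 * \sum_(1 <= h < n.+1) c h.
    apply: (le_trans (csum_sqr_le _ _)); rewrite lerD2l ler_wpM2l //.
    rewrite big_add1 /= big_mkord; apply: ler_sum => i _; exact: ler_norm.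
  have nLr : n%:R <= L%:R :> R by rewrite ler_nat.
  have KLr : 2 * K%:R ^+ 2 <= L%:R :> R by rewrite -natrX -natrM ler_nat.
  have sq : L%:R ^+ 2 <= K%:R ^+ 2 * (csum phi n) ^+ 2.
    by rewrite -(real_normK (num_real (csum phi n))) -exprMn lerXn2r // nnegrE // mulr_ge0.
  rewrite -(ler_nat R) natrM.
  move: sumle sqle sq KLr B0; rewrite natrM natrX.
  move: (size _)%:R (\sum_(1 <= h < n.+1) c h) (csum phi n ^+ 2) => sz T C2.
  move: (L%:R) (K%:R) (n%:R) L0r nLr => l k m l0 ml sumle sqle sq kl k8.
  have k20 : 0 < k ^+ 2 by lra.
  have h1 : l ^+ 2 <= k ^+ 2 * (m + 2 * T).
    by apply: (le_trans sq); rewrite ler_wpM2l // ltW.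
  have h2 : k ^+ 2 * T <= k ^+ 2 * (sz * l) + l ^+ 2 / 8.
    have -> : l ^+ 2 / 8 = k ^+ 2 * (l * (l / (8 * k ^+ 2))).
      by field; rewrite -sqrf_eq0 gt_eqF.
    by rewrite -mulrDr ler_wpM2l // ltW.
  have h3 : k ^+ 2 * m <= l ^+ 2 / 2.
    have : k ^+ 2 * m <= k ^+ 2 * l by rewrite ler_wpM2l // ltW.
    have : 2 * k ^+ 2 * l <= l * l by rewrite ler_wpM2r // ltW.
    by rewrite expr2; lra.
  have : l * l <= (8 * k ^+ 2 * sz) * l.
    have : k ^+ 2 * (sz * l) = k ^+ 2 * sz * l by ring.
    by rewrite -expr2; lra.
  by rewrite ler_pM2r.
- move=> h; rewrite mem_filter mem_index_iota => /andP[Ph /andP[_ hn]]; by split.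
Qed.

End CosSums.

Section PolyPhase.
Variable R : realType.
Implicit Types (phi psi : nat -> R) (g : R).

(* [phi] is a polynomial of degree at most [d] whose coefficient of degree [d] is [g];
   the finite-difference form is the one Weyl differencing consumes. *)
Fixpoint polyphase (d : nat) (g : R) (phi : nat -> R) : Prop :=
  if d is d'.+1 then forall h, polyphase d' (d%:R * g * h%:R) (shift_diff phi h)
  else forall x, phi x = g.

Lemma polyphaseD d g g' phi psi : polyphase d g phi -> polyphase d g' psi ->
  polyphase d (g + g') (fun x => phi x + psi x).
Proof.
elim: d g g' phi psi => [|d IH] g g' phi psi /= H H'; first by move=> x; rewrite H H'.
move=> h; have := IH _ _ _ _ (H h) (H' h).
rewrite mulrDr mulrDl; congr polyphase; apply: funext => x.
by rewrite /shift_diff; ring.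
Qed.

Lemma polyphaseZ d g phi (c : R) : polyphase d g phi ->
  polyphase d (c * g) (fun x => c * phi x).
Proof.
elim: d g phi => [|d IH] g phi /= H; first by move=> x; rewrite H.
move=> h; have := IH _ _ (H h).
rewrite (_ : c * _ = d.+1%:R * (c * g) * h%:R); last by ring.
by congr polyphase; apply: funext => x; rewrite /shift_diff mulrBr.
Qed.

Lemma polyphaseS d g phi : polyphase d g phi -> polyphase d.+1 0 phi.
Proof.
elim: d g phi => [|d IH] g phi H h.
  by move=> x; rewrite /shift_diff !H mulr0 mul0r subrr.
by rewrite mulr0 mul0r; apply: IH (H h).
Qed.

Lemma polyphase_lt d d' g phi : (d < d')%N -> polyphase d g phi -> polyphase d' 0 phi.
Proof.
move=> lt; have := polyphaseS; elim: d' lt => // d' IH; rewrite ltnS leq_eqVlt.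
case/predU1P => [->|/IH H] S P; first exact: S P.
exact: S (H S P).
Qed.

Lemma polyphase_affine d g phi (q v : nat) : polyphase d g phi ->
  polyphase d (g * q%:R ^+ d) (fun u => phi (v + q * u)%N).
Proof.
elim: d g phi => [|d IH] g phi H; first by move=> x; rewrite H mulr1.
move=> h; have := IH _ _ (H (q * h)%N).
rewrite (_ : _ * _ ^+ d = d.+1%:R * (g * q%:R ^+ d.+1) * h%:R); last first.
  by rewrite natrM exprS; ring.
congr polyphase; apply: funext => x; rewrite /shift_diff; congr (phi _ - _); lia.
Qed.

(** The discrete product rule: differencing [x * phi x] by [h] gives [x] times the difference of
    [phi], plus [h * phi (x + h)]. *)
Lemma polyphase_mulX d g phi : polyphase d g phi ->
  polyphase d.+1 g (fun x => x%:R * phi x).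
Proof.
elim: d g phi => [|d IH] g phi H h.
  by move=> x; rewrite /shift_diff !H natrD; ring.
have H1 := IH _ _ (H h).
have H2 : polyphase d.+1 (h%:R * g) (fun x => h%:R * phi (h + 1 * x)%N).
  apply: polyphaseZ; have := @polyphase_affine _ _ _ 1 h H.
  by rewrite expr1n mulr1.
have := polyphaseD H1 H2.
rewrite (_ : _ + _ = d.+2%:R * g * h%:R); last by rewrite -[d.+2%:R]natr1; ring.
congr polyphase; apply: funext => x; rewrite /shift_diff mul1n addnC natrD; ring.
Qed.

Lemma polyphase_Xn d : polyphase d 1 (fun x => x%:R ^+ d).
Proof.
elim: d => [|d IH] //=; have := polyphase_mulX IH.
by congr polyphase; apply: funext => x; rewrite exprS.
Qed.

Lemma polyphase_cst d (c : R) : polyphase d.+1 0 (fun=> c).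
Proof. by apply: (@polyphase_lt 0 d.+1 c). Qed.

Lemma polyphase_poly d (g : nat -> R) :
  polyphase d (g d) (fun x => \sum_(t < d.+1) g t * x%:R ^+ t).
Proof.
have low m : (m <= d)%N -> polyphase d 0 (fun x => \sum_(t < m) g t * x%:R ^+ t).
  elim: m => [|m IH] md.
    case: d {md} => [|d]; first by move=> x; rewrite big_ord0.
    have := polyphase_cst d 0; congr polyphase.
    by apply: funext => x; rewrite big_ord0.
  have H2 := polyphase_lt md (polyphaseZ (g m) (polyphase_Xn m)).
  have := polyphaseD (IH (ltnW md)) H2; rewrite addr0; congr polyphase.
  by apply: funext => x; rewrite big_ord_recr.
have := polyphaseD (low d (leqnn d)) (polyphaseZ (g d) (polyphase_Xn d)).
rewrite add0r mulr1; congr polyphase.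
by apply: funext => x; rewrite big_ord_recr.
Qed.

End PolyPhase.

(** * Weyl's inequality for the leading coefficient *)

Section Weyl.
Variable R : realType.

Lemma leq_exp2_pexp (K c e : nat) : (2 <= K)%N -> (c <= 2 ^ e)%N -> (c <= K ^ e)%N.
Proof. by move=> K2 ce; apply: (leq_trans ce); case: e {ce} => // e; rewrite leq_exp2r. Qed.

Lemma expn_bigger n : (n <= 2 ^ n)%N.
Proof. exact: ltnW (ltn_expl n (ltnSn 1)). Qed.

Lemma ler_pexpK (K a b : nat) : (0 < K)%N -> (a <= b)%N -> (K ^ a)%:R <= (K ^ b)%:R :> R.
Proof. by move=> K0 ab; rewrite ler_nat leq_pexp2l. Qed.

(** Induction on the degree, starting from the geometric sum. Differencing by [h] gives the leading
    coefficient [d.+2 * g * h], for which the induction hypothesis supplies a [q] depending on [h].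
    Pigeonhole fixes a common [q], and Vinogradov's lemma removes [h] and gains the missing factor
    [L]. *)
Lemma weyl_leading (d : nat) : exists E : nat, forall (K L n : nat) (g : R) (phi : nat -> R),
  (2 <= K)%N -> (0 < L)%N -> (n <= L)%N -> polyphase d.+1 g phi ->
  L%:R <= K%:R * `|csum phi n| ->
  exists q, (1 <= q <= K ^ E)%N /\ nearint ((K ^ E)%:R / L%:R ^+ d.+1) (q%:R * g).
Proof.
elim: d => [|d [E IH]].
  exists 1%N => K L n g phi K2 L0 nL P big; exists 1%N; split.
    by rewrite expn1 (ltnW K2).
  rewrite mul1r expn1 expr1; apply: nearint_le (nearint_sinpi g).
  have Ephi : phi = (fun x => g * x%:R + phi 0%N).
    apply: funext => x; have := P x 0%N; rewrite /shift_diff add0n mul1r => <-.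
    by rewrite subrK.
  have L0r : 0 < L%:R :> R by rewrite ltr0n.
  have := geometric_csum g (phi 0%N) n; rewrite -Ephi => gs.
  rewrite ler_pdivlMr //; apply: (le_trans (y := `|sin (pi * g)| * (K%:R * `|csum phi n|))).
    by rewrite ler_wpM2l.
  by rewrite mulrCA [X in _ * X]mulrC ler_piMr.
pose F := (20 * E + 28)%N.
exists (F * d.+2 + d.+3)%N => K L n g phi K2 L0 nL P big.
have K0 : (0 < K)%N by apply: leq_trans K2.
have L0r : 0 < L%:R :> R by rewrite ltr0n.
(* For short sums the claimed error is at least 1 and [q = 1] works; otherwise [K ^ F <= L] supplies
   the size conditions of [weyl_step] and [vinogradov]. *)
case: (ltnP L (K ^ F)) => LF.
  exists 1%N; split; first by rewrite expn_gt0 K0.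
  apply: nearint1; rewrite ler_pdivlMr ?exprn_gt0 // mul1r -natrX ler_nat.
  apply: (leq_trans (n := ((K ^ F) ^ d.+2)%N)); first by rewrite leq_exp2r // ltnW.
  by rewrite -expnM leq_pexp2l // leq_addr.
have K8 : (8 * K ^ 2 <= K ^ 5)%N.
  by rewrite (expnD K 3 2) leq_mul2r (leq_exp2_pexp K2) ?orbT.
have [] := @weyl_step R phi K L n K0 L0 nL _ big.
  apply: (leq_trans _ LF); apply: (leq_trans (n := K ^ 5)); last by rewrite leq_pexp2l // /F; lia.
  by apply: leq_trans K8; rewrite leq_mul2r orbT.
move=> s [us rs ss ms].
have ex h : exists q, h \in s -> (1 <= q <= (K ^ 5) ^ E)%N /\
    nearint (((K ^ 5) ^ E)%:R / L%:R ^+ d.+1) (q%:R * (d.+2%:R * g * h%:R)).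
  case hs : (h \in s); last by exists 0%N.
  have [hn hb] := ms _ hs.
  have [|||q Hq] := IH (K ^ 5)%N L (n - h)%N (d.+2%:R * g * h%:R) (shift_diff phi h) _ L0 _ (P h).
  - by apply: (leq_trans K2); rewrite -[X in (X <= _)%N]expn1 leq_pexp2l.
  - by apply: leq_trans nL; apply: leq_subr.
  - by apply: (le_trans hb); rewrite ler_wpM2r // ler_nat.
  by exists q.
have {ex} [qf Hq] := choice ex.
have [] := @pigeonhole _ s qf (K ^ (5 * E)).+1 => //.
  by move=> h /Hq [/andP[_ +] _]; rewrite ltnS expnM.
move=> q _ HF; set s' := [seq x <- s | _] in HF.
pose K2' := (K ^ (5 * E + 6))%N.
have L0s : (0 < size s')%N.
  by case: (size s') HF ss => // ; rewrite muln0 leqn0 => /eqP ->; rewrite muln0; move: L0; clear; lia.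
have LF' : (L <= K2' * size s')%N.
  apply: (leq_trans ss); apply: (leq_trans (n := (K ^ 5 * (K ^ (5 * E) * K * size s'))%N)).
    apply: leq_mul => //; apply: (leq_trans HF); rewrite leq_mul2r; apply/orP; right.
    have : (0 < K ^ (5 * E))%N by rewrite expn_gt0 K0.
    by move: K2; clear; nia.
  by rewrite -expnSr mulnA -expnD /K2' leq_mul2r leq_pexp2l ?orbT //; lia.
have K2'0 : (0 < K2')%N by rewrite expn_gt0 K0.
have [h0 h0s] : exists h, h \in s'.
  by move: L0s; case: (s') => // h t _; exists h; rewrite mem_head.
have [q1 qE] : (1 <= q)%N /\ (q <= K ^ (5 * E))%N.
  move: h0s; rewrite mem_filter => /andP[/eqP <- /Hq [/andP[-> +] _]].
  by rewrite expnM.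
pose eps : R := (K ^ (5 * E))%:R / L%:R ^+ d.+1.
have [] := @vinogradov R K2' L s' eps (q%:R * d.+2%:R * g) K2'0.
- exact: filter_uniq.
- by move=> h; rewrite mem_filter => /andP[_ /rs].
- move=> h; rewrite mem_filter => /andP[/eqP <- /Hq [_]].
  by rewrite -expnM -/eps; congr nearint; ring.
- exact: LF'.
- apply: leq_trans LF; rewrite /K2' -expnM.
  apply: (leq_trans (n := K ^ 3 * K ^ ((5 * E + 6) * 2))%N).
    by rewrite leq_mul2r (leq_exp2_pexp K2) ?orbT.
  by rewrite -expnD leq_pexp2l // /F; lia.
- rewrite /eps mulrA ltr_pdivrMr ?exprn_gt0 // mul1r -!natrX -[512]/(512%:R) -!natrM ltr_nat.
  apply: (leq_trans (n := (K ^ F)%N)); last first.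
    by apply: (leq_trans LF); rewrite -[X in (X <= _)%N]expn1 leq_pexp2l.
  rewrite /K2' -expnM; apply: (leq_trans (n := K ^ 10 * K ^ ((5 * E + 6) * 3) * K ^ (5 * E))%N).
    rewrite ltn_pmul2r ?expn_gt0 ?K0 // ltn_pmul2r ?expn_gt0 ?K0 //.
    exact: (leq_exp2_pexp (e := 10) K2).
  by rewrite -!expnD leq_pexp2l // /F; lia.
move=> q' [/andP[q'1 q'K] near].
exists (q' * q * d.+2)%N; split.
  rewrite !muln_gt0 q1 q'1 /=.
  apply: (leq_trans (n := ((K ^ (1 + (5 * E + 6))) * K ^ (5 * E) * K ^ d.+2)%N)).
    apply: leq_mul; last by apply: leq_exp2_pexp => //; apply: expn_bigger.
    apply: leq_mul => //; apply: (leq_trans q'K); rewrite expnD expn1.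
    by rewrite leq_mul2r K2 orbT.
  by rewrite -!expnD leq_pexp2l // /F; move: (d) (E); clear; nia.
rewrite !natrM -!mulrA (mulrA q%:R); apply: nearint_le near.
rewrite /eps mulrA -[X in X <= _]mulrA -invfM -exprSr ler_wpM2r ?invr_ge0 ?exprn_ge0 ?ler0n //.
rewrite -!natrX -[32]/(32%:R) -!natrM ler_nat /K2' -expnM.
apply: (leq_trans (n := (K ^ 5 * K ^ ((5 * E + 6) * 3) * K ^ (5 * E))%N)).
  by rewrite !leq_mul2r (leq_exp2_pexp (e := 5) K2) ?orbT.
by rewrite -!expnD leq_pexp2l // /F; move: (d) (E); clear; nia.
Qed.

End Weyl.

(** * Rational approximation of all coefficients of a polynomial phase *)

Section WeylInverse.
Variable R : realType.
Implicit Types phi psi : nat -> R.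

Lemma csum_shift phi (a n : nat) :
  `|csum (fun x => phi (x + a)%N) n - csum phi n| <= 2 * a%:R.
Proof.
elim: a => [|a IH].
  rewrite mulr0 normr_le0 subr_eq0; apply/eqP; congr csum.
  by apply: funext => x; rewrite addn0.
have step : csum (fun x => phi (x + a.+1)%N) n - csum (fun x => phi (x + a)%N) n =
    cos (2 * pi * phi (n + a)%N) - cos (2 * pi * phi a).
  rewrite /csum; elim: n {IH} => [|n IHn]; first by rewrite !big_ord0 add0n !subrr.
  rewrite !big_ord_recr /= opprD addrACA IHn addnS addSn; ring.
have -> : csum (fun x => phi (x + a.+1)%N) n - csum phi n =
  (csum (fun x => phi (x + a.+1)%N) n - csum (fun x => phi (x + a)%N) n) +
  (csum (fun x => phi (x + a)%N) n - csum phi n) by ring.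
apply: (le_trans (ler_normD _ _)).
rewrite step -[a.+1%:R]natr1.
have := ler_normB (cos (2 * pi * phi (n + a)%N)) (cos (2 * pi * phi a)).
have := cos_max (2 * pi * phi (n + a)%N); have := cos_max (2 * pi * phi a).
lra.
Qed.

(** Average over all starting points [m]: for each [u] the shifted sum differs from the full one by
    at most [2 * q * L'], so at most half is lost when [4 * K * q * L' <= L]. *)
Lemma csum_progression phi (K L L' q : nat) :
  (0 < K)%N -> (0 < L)%N -> (4 * K * q * L' <= L)%N -> L%:R <= K%:R * `|csum phi L| ->
  exists2 m, (m < L)%N & L'%:R <= (2 * K)%:R * `|csum (fun u => phi (m + q * u)%N) L'|.
Proof.
move=> K0 L0 qL big; apply: contrapT => no.
have L0r : 0 < L%:R :> R by rewrite ltr0n.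
have lt (m : 'I_L) : (2 * K)%:R * `|csum (fun u => phi (m + q * u)%N) L'| <= L'%:R.
  by rewrite leNgt; apply/negP => le; apply: no; exists m => //; apply: ltW.
have [L'0|L'0] := posnP L'.
  by apply: no; exists 0%N; rewrite // L'0 mulr_ge0 // ler0n.
have L'0r : 0 < L'%:R :> R by rewrite ltr0n.
have lts : (2 * K)%:R * `|\sum_(m < L) csum (fun u => phi (m + q * u)%N) L'| < L%:R * L'%:R.
  apply: (@le_lt_trans _ _ ((2 * K)%:R * \sum_(m < L) `|csum (fun u => phi (m + q * u)%N) L'|)).
    by rewrite ler_wpM2l ?ler0n // ler_norm_sum.
  rewrite mulr_sumr.
  have -> : L%:R * L'%:R = \sum_(m < L) L'%:R :> R by rewrite sumr_const card_ord mulr_natl.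
  apply: ltr_sum; first by apply/hasP; exists (Ordinal L0); rewrite ?mem_index_enum.
  move=> m _; rewrite ltNge; apply/negP => le; apply: no; exists m => //.
have dist : `|\sum_(m < L) csum (fun u => phi (m + q * u)%N) L' - L'%:R * csum phi L| <=
    L'%:R * (2 * (q * L')%:R).
  rewrite /csum exchange_big /=.
  have -> : L'%:R * \sum_(x < L) cos (2 * pi * phi x) = \sum_(u < L') csum phi L.
    by rewrite sumr_const card_ord mulr_natl.
  rewrite -sumrB; apply: (le_trans (ler_norm_sum _ _ _)).
  have -> : L'%:R * (2 * (q * L')%:R) = \sum_(u < L') (2 * (q * L')%:R) :> R.
    by rewrite sumr_const card_ord mulr_natl.
  apply: ler_sum => u _; apply: (le_trans (csum_shift phi (q * u) L)).
  by rewrite ler_wpM2l // ler_nat leq_mul2l ltnW ?orbT.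
have qLr : 4 * K%:R * (q * L')%:R <= L%:R :> R.
  by rewrite -[4]/(4%:R) -!natrM ler_nat mulnA.
move: lts dist; set S := \sum_(m < L) _ => lts dist.
have tri : L'%:R * `|csum phi L| <= `|S| + L'%:R * (2 * (q * L')%:R).
  have -> : L'%:R * `|csum phi L| = `|L'%:R * csum phi L| by rewrite normrM normr_nat.
  have -> : L'%:R * csum phi L = S - (S - L'%:R * csum phi L) by rewrite subKr.
  by apply: (le_trans (ler_normB _ _)); rewrite lerD2l.
have h1 : L'%:R * L%:R <= L'%:R * (K%:R * `|csum phi L|) by rewrite ler_wpM2l ?ler0n.
have h2 : L'%:R * (4 * K%:R * (q * L')%:R) <= L'%:R * L%:R :> R by rewrite ler_wpM2l ?ler0n.
have h3 : K%:R * (L'%:R * `|csum phi L|) <= K%:R * (`|S| + L'%:R * (2 * (q * L')%:R)).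
  by rewrite ler_wpM2l ?ler0n.
move: lts h1 h2 h3; rewrite (natrM _ 2 K).
move: (`|S|) (`|csum phi L|) (K%:R : R) ((q * L')%:R : R) (L%:R : R) (L'%:R : R) => a b k v l l'.
lra.
Qed.

(** An integral mean value bound; divisibility by [b] later exposes the factor [q] in the increments
    of a polynomial along a progression. *)
Lemma addn_expn_expand (a b t : nat) :
  exists2 Y, ((a + b) ^ t = a ^ t + b * Y)%N & (Y <= t * (a + b) ^ t.-1)%N.
Proof.
elim: t => [|t [Y E le]]; first by exists 0%N; rewrite ?muln0.
exists (a ^ t + (a + b) * Y)%N; first by rewrite !expnS E; ring.
rewrite mulSn /= leq_add //; first by case: t {E le} => // t; rewrite leq_exp2r // leq_addr.
case: t E le => [|t] E le; first by move: le; rewrite mul0n leqn0 => /eqP ->; rewrite muln0.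
by rewrite (expnS _ t) mulnCA leq_mul2l le orbT.
Qed.

Lemma cos_nearint (e x y : R) : nearint e (x - y) ->
  `|cos (2 * pi * x) - cos (2 * pi * y)| <= 8 * e.
Proof.
move=> [z Hz]; rewrite -(cos2piDz y z).
apply: (le_trans (cos_lipschitz _ _)).
rewrite -mulrBr opprD addrA normrM ger0_norm ?mulr_ge0 ?pi_ge0 //.
have p4 : pi <= 4 :> R by have := pihalf_lt2 R; lra.
have e0 : 0 <= e by apply: le_trans Hz.
apply: ler_pM => //; first by rewrite mulr_ge0 // pi_ge0.
by lra.
Qed.

(* Along [m + q * u] with [u < L / K ^ F], the terms of degree [> s] are constant modulo 1
   up to a small error, so the coefficient of degree [s] becomes the leading one. *)
Lemma weyl_inverse_step (D s E : nat) : exists E' : nat,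
  forall (K L q : nat) (g : nat -> R), (0 < s <= D)%N -> (2 <= K)%N -> (0 < L)%N ->
  L%:R <= K%:R * `|csum (fun x => \sum_(t < D.+1) g t * x%:R ^+ t) L| ->
  (1 <= q <= K ^ E)%N ->
  (forall t, (s < t <= D)%N -> nearint ((K ^ E)%:R / L%:R ^+ t) (q%:R * g t)) ->
  exists q', (1 <= q' <= K ^ E')%N /\
    forall t, (s <= t <= D)%N -> nearint ((K ^ E')%:R / L%:R ^+ t) (q'%:R * g t).
Proof.
have [Es lead] := weyl_leading R s.-1.
pose F := (3 * D + E + 6)%N.
exists (3 * Es + E * D + E + F.+1 * D)%N => K L q g /andP[s0 sD] K2 L0 big /andP[q1 qE] near.
have K0 : (0 < K)%N by apply: leq_trans K2.
have L0r : 0 < L%:R :> R by rewrite ltr0n.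
set E' := (_ + _)%N.
have FE : (F * D <= E')%N by rewrite /E' (mulSn F); move: (F * D)%N; clear; lia.
case: (ltnP L (K ^ F)) => LF.
  exists 1%N; split; first by rewrite expn_gt0 K0.
  move=> t /andP[_ tD].
  apply: nearint1; rewrite ler_pdivlMr ?exprn_gt0 // mul1r -natrX ler_nat.
  apply: (leq_trans (n := ((K ^ F) ^ t)%N)).
    by case: t {tD} => // t; rewrite leq_exp2r // ltnW.
  by rewrite -expnM leq_pexp2l //; apply: leq_trans FE; rewrite leq_mul2l tD orbT.
set P := fun x : nat => _ in big.
pose L' := (L %/ K ^ F)%N.
have KF0 : (0 < K ^ F)%N by rewrite expn_gt0 K0.
have L'0 : (0 < L')%N by rewrite divn_gt0.
have L'L : (L' * K ^ F <= L)%N by apply: leq_trunc_div.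
have LL' : (L <= 2 * K ^ F * L')%N.
  have := ltn_ceil L KF0; rewrite -/L' mulSn; move: L'0 KF0; clear; nia.
have KqL : (4 * K * q * L' <= L)%N.
  apply: leq_trans L'L; rewrite mulnC leq_mul2l; apply/orP; right.
  apply: (leq_trans (n := (K ^ 2 * K * K ^ E)%N)).
    by apply: leq_mul => //; rewrite leq_mul2r (leq_exp2_pexp (e := 2) K2) ?orbT.
  by rewrite -expnSr -expnD leq_pexp2l // /F; lia.
have [m mL big'] := csum_progression K0 L0 KqL big.
pose high u : R := \sum_(s.+1 <= t < D.+1) g t * (m + q * u)%:R ^+ t.
pose low u : R := \sum_(t < s.+1) g t * (m + q * u)%:R ^+ t.
have Psplit u : P (m + q * u)%N = low u + high u.
  rewrite /P /low /high -(big_mkord xpredT (fun t => g t * (m + q * u)%:R ^+ t)).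
  by rewrite (big_cat_nat (n := s.+1)) //= big_mkord.
have nearhigh u : (u < L')%N -> nearint ((32 * K)%:R^-1) (high u - high 0%N).
  move=> uL; rewrite /high -sumrB.
  pose e : R := (K ^ (2 * D + E))%:R / (K ^ F)%:R.
  apply: (@nearint_le _ (\sum_(s.+1 <= t < D.+1) e)); last first.
    rewrite !big_nat; apply: nearint_sum => t /andP[st tD].
    have [Y EY leY] := addn_expn_expand m (q * u) t.
    rewrite -mulrBr -!natrX EY muln0 addn0 natrD addrC addKr.
    (* The increment carries a factor [q], so it is an integer multiple of [q * g t], which [near]
       controls. *)
    have -> : g t * (q * u * Y)%:R = (u * Y)%:R * (q%:R * g t) by rewrite !natrM; ring.
    apply: nearint_le (nearintMn (u * Y) (near t _)); last by rewrite st -ltnS.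
    rewrite /e ler_pdivlMr ?ltr0n // mulrA -mulrAC ler_pdivrMr ?exprn_gt0 //.
    rewrite -natrX -!natrM ler_nat.
    have t0 : (0 < t)%N by apply: leq_trans st.
    have m2 : (m + q * u <= 2 * L)%N.
      have : (q * u <= L)%N.
        apply: leq_trans KqL; apply: (leq_trans (n := (q * L')%N)).
          by rewrite leq_mul2l ltnW ?orbT.
        by rewrite -mulnA leq_pmull // muln_gt0 K0.
      by move: mL; clear; lia.
    have YL : (u * Y * K ^ F <= D * 2 ^ D * L ^ t)%N.
      apply: (leq_trans (n := (Y * L)%N)).
        rewrite mulnAC mulnC leq_mul2l; apply/orP; right.
        by apply: leq_trans L'L; rewrite leq_mul2r ltnW ?orbT.
      apply: (leq_trans (n := (t * (2 * L) ^ t.-1 * L)%N)).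
        rewrite leq_mul2r; apply/orP; right; apply: (leq_trans leY).
        rewrite leq_mul2l; apply/orP; right.
        by case: (t.-1) => // t'; rewrite leq_exp2r.
      rewrite -[in X in (_ <= X)%N](prednK t0) expnMn expnSr !mulnA leq_mul2r; apply/orP; right.
      rewrite leq_mul2r; apply/orP; right; apply: leq_mul => //.
      by rewrite leq_pexp2l //; move: tD; clear; lia.
    apply: (leq_trans (n := (D * 2 ^ D * L ^ t * K ^ E)%N)).
      by rewrite mulnAC leq_mul2r YL orbT.
    rewrite [X in (X <= _)%N]mulnAC leq_mul2r expnD leq_mul2r; apply/orP; right.
    apply/orP; right; rewrite mul2n -addnn expnD.
    by apply: leq_mul; apply: leq_exp2_pexp => //; apply: expn_bigger.
  rewrite sumr_const_nat -[X in X <= _]mulr_natl.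
  apply: (@le_trans _ _ (D%:R * e)).
    rewrite ler_wpM2r ?divr_ge0 ?ler0n // ler_nat; move: s0; clear; lia.
  rewrite /e mulrA ler_pdivrMr ?ltr0n // [X in _ <= X]mulrC ler_pdivlMr ?ltr0n ?muln_gt0 ?K0 //.
  rewrite -!natrM ler_nat.
  apply: (leq_trans (n := (K ^ D * K ^ (2 * D + E) * (K ^ 5 * K))%N)).
    apply: leq_mul; last by rewrite leq_mul2r (leq_exp2_pexp (e := 5) K2) ?orbT.
    by rewrite leq_mul2r; apply/orP; right; apply: leq_exp2_pexp => //; apply: expn_bigger.
  by rewrite -expnSr -!expnD leq_pexp2l // /F; lia.
have big2 : L'%:R <= (K ^ 3)%:R * `|csum (fun u => low u + high 0%N) L'|.
  have : `|csum (fun u => P (m + q * u)%N) L' - csum (fun u => low u + high 0%N) L'|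
      <= L'%:R * (8 * ((32 * K)%:R^-1)).
    apply: csum_dist => u uL; apply: cos_nearint.
    have -> : P (m + q * u)%N - (low u + high 0%N) = high u - high 0%N by rewrite Psplit; ring.
    exact: nearhigh.
  have K1r : 0 < K%:R :> R by rewrite ltr0n.
  have -> : 8 * (32 * K)%:R^-1 = (4 * K%:R)^-1 :> R.
    by rewrite natrM; field; rewrite gt_eqF.
  have K4 : 4 * K%:R <= (K ^ 3)%:R :> R.
    rewrite -[4]/(4%:R) -natrM ler_nat (expnSr K 2) leq_mul2r.
    by rewrite (leq_exp2_pexp (e := 2) K2) ?orbT.
  move: big'; set A := csum _ L'; set B := csum _ L' => bigA dAB.
  have tri : `|A| <= `|A - B| + `|B|.
    by rewrite -[X in `|X| <= _](subrK B); apply: ler_normD.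
  have h1 : 4 * K%:R * `|A - B| <= L'%:R.
    apply: (@le_trans _ _ (4 * K%:R * (L'%:R / (4 * K%:R)))).
      by rewrite ler_wpM2l // mulr_ge0 ?ler0n.
    by rewrite mulrC divfK // gt_eqF //; lra.
  have h2 : 4 * K%:R * `|A| <= 4 * K%:R * (`|A - B| + `|B|).
    by rewrite ler_wpM2l // mulr_ge0 ?ler0n.
  have : 4 * K%:R * `|B| <= (K ^ 3)%:R * `|B| by rewrite ler_wpM2r.
  by move: bigA; rewrite natrM; lra.
(* Frozen at [u = 0], [high] only adds a constant, and since [s > 0] the leading coefficient in [u]
   is [g s * q ^ s]. *)
have P2 : polyphase s (g s * q%:R ^+ s) (fun u => low u + high 0%N).
  rewrite -[X in polyphase _ X]addr0; apply: polyphaseD.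
    by have := @polyphase_affine R s (g s) _ q m (polyphase_poly s g).
  by rewrite -(prednK s0); apply: polyphase_cst.
have [] := lead (K ^ 3)%N L' L' (g s * q%:R ^+ s) (fun u => low u + high 0%N) _ L'0 (leqnn _) _ big2.
- by apply: (leq_trans K2); rewrite -[X in (X <= _)%N]expn1 leq_pexp2l.
- by rewrite prednK.
move=> q' [/andP[q'1 q'E] near'].
exists (q' * q ^ s)%N; split.
  rewrite muln_gt0 q'1 expn_gt0 q1 /=.
  apply: (leq_trans (n := (K ^ (3 * Es) * K ^ (E * D))%N)).
    apply: leq_mul; first by rewrite expnM.
    apply: (leq_trans (n := ((K ^ E) ^ s)%N)); first by rewrite leq_exp2r.
    by rewrite -expnM leq_pexp2l // leq_mul2l sD orbT.
  by rewrite -expnD leq_pexp2l // /E'; lia.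
move=> t /andP[st tD].
case: (ltngtP s t) st => // [lt|<-] _.
  have -> : (q' * q ^ s)%:R * g t = (q' * q ^ s.-1)%:R * (q%:R * g t).
    by rewrite mulrA -natrM -mulnA -expnSr prednK.
  apply: nearint_le (nearintMn _ (near t _)); last by rewrite lt.
  rewrite mulrA ler_wpM2r ?invr_ge0 ?exprn_ge0 ?ler0n // -natrM ler_nat.
  apply: (leq_trans (n := (K ^ (3 * Es) * K ^ (E * D) * K ^ E)%N)).
    rewrite leq_mul2r; apply/orP; right; apply: leq_mul; first by rewrite expnM.
    apply: (leq_trans (n := ((K ^ E) ^ s.-1)%N)).
      by case: (s.-1) => // s'; rewrite leq_exp2r.
    by rewrite -expnM leq_pexp2l // leq_mul2l; apply/orP; right; move: sD; clear; lia.
  by rewrite -!expnD leq_pexp2l // /E'; lia.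
move: near'; rewrite prednK // => near'.
have -> : (q' * q ^ s)%:R * g s = q'%:R * (g s * q%:R ^+ s) by rewrite natrM natrX; ring.
apply: nearint_le near'.
rewrite ler_pdivrMr ?exprn_gt0 ?ltr0n // mulrAC ler_pdivlMr ?exprn_gt0 //.
rewrite -!natrX -!natrM ler_nat -expnM.
apply: (leq_trans (n := (K ^ (3 * Es) * (2 * K ^ F * L') ^ s)%N)).
  by rewrite leq_mul2l leq_exp2r // LL' orbT.
rewrite expnMn mulnA leq_mul2r; apply/orP; right.
apply: (leq_trans (n := (K ^ (3 * Es) * (K ^ F.+1) ^ s)%N)).
  by rewrite leq_mul2l leq_exp2r // expnS leq_mul2r K2 !orbT.
rewrite -expnM -expnD leq_pexp2l // /E'.
have : (F.+1 * s <= F.+1 * D)%N by rewrite leq_mul2l sD orbT.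
move: (F.+1 * D)%N (F.+1 * s)%N; clear; lia.
Qed.

(** From the top degree down: [j] counts the coefficients that already share a denominator, and
    [weyl_inverse_step] adds one more. *)
Lemma weyl_inverse (D : nat) : exists E : nat, forall (K L : nat) (g : nat -> R),
  (2 <= K)%N -> (0 < L)%N ->
  L%:R <= K%:R * `|csum (fun x => \sum_(t < D.+1) g t * x%:R ^+ t) L| ->
  exists q, (1 <= q <= K ^ E)%N /\
    forall t, (1 <= t <= D)%N -> nearint ((K ^ E)%:R / L%:R ^+ t) (q%:R * g t).
Proof.
suff H j : (j <= D)%N -> exists E : nat, forall (K L : nat) (g : nat -> R),
  (2 <= K)%N -> (0 < L)%N ->
  L%:R <= K%:R * `|csum (fun x => \sum_(t < D.+1) g t * x%:R ^+ t) L| ->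
  exists q, (1 <= q <= K ^ E)%N /\
    forall t, (D - j < t <= D)%N -> nearint ((K ^ E)%:R / L%:R ^+ t) (q%:R * g t).
  have [E HE] := H D (leqnn D); exists E => K L g K2 L0 big.
  by have [q [q1 Hq]] := HE K L g K2 L0 big; exists q; split => // t; move: (Hq t); rewrite subnn.
elim: j => [|j IH] jD.
  exists 0%N => K L g K2 L0 big; exists 1%N; split => // t; rewrite subn0; lia.
have [E HE] := IH (ltnW jD).
have [E' HE'] := weyl_inverse_step D (D - j) E.
exists E' => K L g K2 L0 big.
have [q [q1 Hq]] := HE K L g K2 L0 big.
have [] := HE' K L q g _ K2 L0 big q1 Hq; first by move: jD; clear; lia.
move=> q' [q'1 Hq']; exists q'; split => // t Ht; apply: Hq'.
by move: Ht jD; clear; lia.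
Qed.

End WeylInverse.

(** * Fourier detection *)

Section Kernel.
Variable R : realType.

Lemma cos_mul_cosX (psi y : R) n : cos psi * cos y ^+ n =
  (2 ^+ n)^-1 * \sum_(j < n.+1) 'C(n, j)%:R * cos (psi + (2 * j%:R - n%:R) * y).
Proof.
elim: n psi => [|n IH] psi.
  by rewrite big_ord1 !expr0 invr1 bin0 !mul1r mulr1 mulr0 subrr mul0r addr0.
have -> : cos psi * cos y ^+ n.+1 =
    2^-1 * (cos (psi + y) * cos y ^+ n + cos (psi - y) * cos y ^+ n).
  by rewrite cosD cosB exprS; field.
rewrite !IH -mulrDr mulrA -invfM -exprS; congr (_ * _).
rewrite [RHS]big_ord_recl /= bin0.
under [in RHS]eq_bigr => i _ do rewrite /bump /= add1n binS natrD mulrDl.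
rewrite big_split /= [in RHS]big_ord_recr /= bin_small // mul0r addr0.
rewrite [X in _ + X]big_ord_recl /= bin0 addrCA; congr (_ + _).
  by congr (_ * cos _); rewrite -[n.+1%:R]natr1; ring.
rewrite addrC; congr (_ + _); apply: eq_bigr => i _; congr (_ * cos _).
  by rewrite /bump /= add1n -[n.+1%:R]natr1; ring.
by rewrite -[n.+1%:R]natr1 -[i.+1%:R]natr1; ring.
Qed.

(** Serves to bound from below the Fourier coefficient of the kernel at frequency 0. *)
Lemma central_binomial_ge (r : nat) : (4 ^ r <= (2 * r).+1 * 'C(2 * r, r))%N.
Proof.
elim: r => [|r IH] //.
have h1 := mul_bin_diag (2 * r).+2 r; have h2 := mul_bin_down (2 * r).+1 r.
have E : (2 * r.+1 = (2 * r).+2)%N by lia.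
rewrite E expnS; move: h1 h2 IH => /=.
rewrite (_ : (2 * r).+1 - r = r.+1)%N; last by lia.
move: 'C((2 * r).+2, r.+1) 'C((2 * r).+1, r) 'C(2 * r, r) (4 ^ r)%N => a b c f h1 h2 IH.
have h3 : (r.+1 * a = 2 * ((2 * r).+1 * c))%N by nia.
by nia.
Qed.

Variables (r L : nat) (phi : nat -> nat -> R).

(** A nonnegative kernel equal to 1 at the integers, with nonnegative Fourier coefficients of total
    mass 1 and frequencies in [[-r, r]]; [pk j] is the coefficient at frequency [j - r]. *)
Definition kern (x : R) : R := cos (pi * x) ^+ (2 * r).
Definition pk (j : nat) : R := 'C(2 * r, j)%:R / 2 ^+ (2 * r).
(** The twist [psi] collects the frequencies already chosen, so that the kernels can be expanded one
    at a time. *)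
Definition kernsum (l : nat) (psi : nat -> R) : R :=
  \sum_(m < L) cos (2 * pi * psi m) * \prod_(i < l) kern (phi i m).

Lemma pk_ge0 j : 0 <= pk j.
Proof. by rewrite divr_ge0 ?ler0n // exprn_ge0. Qed.

Lemma pk_sum : \sum_(j < (2 * r).+1) pk j = 1.
Proof.
rewrite -mulr_suml -natr_sum.
have <- : (2 ^ (2 * r) = \sum_(j < (2 * r).+1) 'C(2 * r, j))%N.
  by rewrite (expnDn 1 1); apply: eq_bigr => j _; rewrite !exp1n !muln1.
by rewrite natrX divff // expf_neq0.
Qed.

Lemma kern_expand (x psi : R) : cos (2 * pi * psi) * kern x =
  \sum_(j < (2 * r).+1) pk j * cos (2 * pi * (psi + (j%:Z - r%:Z)%:~R * x)).
Proof.
rewrite /kern cos_mul_cosX mulr_sumr; apply: eq_bigr => j _.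
rewrite /pk mulrA [X in X * _ = _]mulrC; congr (_ * cos _).
by rewrite intrB natrM -!pmulrn; ring.
Qed.

Lemma kernsumS l psi : kernsum l.+1 psi =
  \sum_(j < (2 * r).+1) pk j * kernsum l (fun m => psi m + (j%:Z - r%:Z)%:~R * phi l m).
Proof.
rewrite /kernsum.
under [RHS]eq_bigr => j _ do rewrite mulr_sumr.
rewrite [RHS]exchange_big /=; apply: eq_bigr => m _.
rewrite big_ord_recr /= mulrCA kern_expand mulrC mulr_suml.
by apply: eq_bigr => j _; rewrite mulrA.
Qed.

(** Expanding every kernel writes [kernsum] as a convex combination of cosine sums, by [pk_sum]. *)
Lemma kernsum_le l psi (kappa : R) :
  (forall h : nat -> int, (forall i, (i < l)%N -> `|h i| <= r%:Z) ->
    `|csum (fun m => psi m + \sum_(i < l) (h i)%:~R * phi i m) L| <= kappa) ->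
  `|kernsum l psi| <= kappa.
Proof.
elim: l psi => [|l IH] psi H.
  have := H (fun=> 0) (fun i lt => ltac:(by [])); congr (`|_| <= _).
  by apply: eq_bigr => m _; rewrite !big_ord0 addr0 mulr1.
rewrite kernsumS; apply: (le_trans (ler_norm_sum _ _ _)).
apply: (@le_trans _ _ (\sum_(j < (2 * r).+1) pk j * kappa)); last first.
  by rewrite -mulr_suml pk_sum mul1r.
apply: ler_sum => j _; rewrite normrM (ger0_norm (pk_ge0 j)) ler_wpM2l ?pk_ge0 //.
apply: IH => h hr.
have := H (fun i => if (i < l)%N then h i else j%:Z - r%:Z).
have -> : (fun m => psi m + \sum_(i < l.+1) (if (i < l)%N then h i else j%:Z - r%:Z)%:~R * phi i m)
  = (fun m => psi m + (j%:Z - r%:Z)%:~R * phi l m + \sum_(i < l) (h i)%:~R * phi i m).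
  apply: funext => m; rewrite big_ord_recr /= ltnn -addrA [X in _ + X = _]addrC.
  by do 2!congr (_ + _); apply: eq_bigr => i _; rewrite ltn_ord.
apply => i _; case: ifP => [/hr//|_].
by have := ltn_ord j; lia.
Qed.

(** All frequencies zero give the main term. In the expansion of the last kernel, frequency 0 leads
    to the induction hypothesis; the others make the last entry of [h] nonzero, so together they
    cost at most one [kappa]. *)
Lemma kernsum_ge l (kappa : R) : 0 <= kappa ->
  (forall h : nat -> int, (forall i, (i < l)%N -> `|h i| <= r%:Z) ->
    (exists2 i, (i < l)%N & h i != 0) ->
    `|csum (fun m => \sum_(i < l) (h i)%:~R * phi i m) L| <= kappa) ->
  pk r ^+ l * L%:R - l%:R * kappa <= kernsum l (fun=> 0).
Proof.
move=> k0; elim: l => [|l IH] H.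
  rewrite mul0r subr0 expr0 mul1r /kernsum.
  under eq_bigr do rewrite big_ord0 mulr0 cos0 mulr1.
  by rewrite sumr_const card_ord.
have rr : (r < (2 * r).+1)%N by lia.
rewrite kernsumS (bigD1 (Ordinal rr)) //=.
have -> : (fun m : nat => 0 + (r%:Z - r%:Z)%:~R * phi l m) = (fun=> 0).
  by apply: funext => m; rewrite subrr mul0r addr0.
have H1 : pk r ^+ l * L%:R - l%:R * kappa <= kernsum l (fun=> 0).
  apply: IH => h hr [i0 i0l hi0].
  have := H (fun i => if (i < l)%N then h i else 0).
  have -> : (fun m => \sum_(i < l.+1) (if (i < l)%N then h i else 0)%:~R * phi i m)
     = (fun m => \sum_(i < l) (h i)%:~R * phi i m).
    apply: funext => m; rewrite big_ord_recr /= ltnn mul0r addr0.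
    by apply: eq_bigr => i _; rewrite ltn_ord.
  apply; first by move=> i _; case: ifP => [/hr//|_]; rewrite normr0.
  by exists i0; rewrite ?i0l // ltnW.
have p1 : pk r <= 1.
  rewrite -pk_sum (bigD1 (Ordinal rr)) //= lerDl.
  by apply: sumr_ge0 => j _; apply: pk_ge0.
have H2 : - kappa <= \sum_(j < (2 * r).+1 | j != Ordinal rr)
    pk j * kernsum l (fun m => 0 + (j%:Z - r%:Z)%:~R * phi l m).
  apply: (@le_trans _ _ (\sum_(j < (2 * r).+1 | j != Ordinal rr) pk j * - kappa)).
    rewrite -mulr_suml mulrN lerN2 ler_piMl //.
    rewrite -pk_sum [X in _ <= X](bigD1 (Ordinal rr)) //= lerDr pk_ge0 //.
  apply: ler_sum => j /eqP jr; rewrite ler_wpM2l ?pk_ge0 //.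
  suff : `|kernsum l (fun m => 0 + (j%:Z - r%:Z)%:~R * phi l m)| <= kappa.
    by rewrite ler_norml => /andP[].
  apply: kernsum_le => h hr.
  have := H (fun i => if (i < l)%N then h i else j%:Z - r%:Z).
  have -> : (fun m => \sum_(i < l.+1) (if (i < l)%N then h i else j%:Z - r%:Z)%:~R * phi i m)
    = (fun m => 0 + (j%:Z - r%:Z)%:~R * phi l m + \sum_(i < l) (h i)%:~R * phi i m).
    apply: funext => m; rewrite big_ord_recr /= ltnn add0r addrC; congr (_ + _).
    by apply: eq_bigr => i _; rewrite ltn_ord.
  apply; first by move=> i _; case: ifP => [/hr//|_]; have := ltn_ord j; lia.
  exists l => //; rewrite ltnn subr_eq0; apply/eqP => -[jr']; apply: jr.
  exact: val_inj.
have := ler_wpM2l (pk_ge0 r) H1; rewrite mulrBr mulrA -exprS => H3.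
have : pk r * (l%:R * kappa) <= l%:R * kappa by rewrite ler_piMl // mulr_ge0 ?ler0n.
rewrite -[l.+1%:R]natr1; lra.
Qed.

End Kernel.

Section Detection.
Variable R : realType.

Lemma not_nearint_cos2 (e x : R) : 0 <= e -> ~ nearint e x ->
  cos (pi * x) ^+ 2 <= 1 - e ^+ 2.
Proof.
move=> e0 nx; rewrite cos2sin2 lerD2l lerN2 -(real_normK (num_real (sin _))).
rewrite lerXn2r ?nnegrE // leNgt; apply/negP => lt; apply: nx.
exact: nearint_le (ltW lt) (nearint_sinpi x).
Qed.

(** With [u = 1 / k ^ 2], Bernoulli's inequality gives [(1 + u) ^ (k ^ 2) >= 2], while
    [(1 - u) * (1 + u) <= 1]. *)
Lemma one_sub_pow_le (k b : nat) : (0 < k)%N ->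
  (1 - (k%:R ^+ 2)^-1) ^+ (k ^ 2 * b) <= (2 ^+ b)^-1 :> R.
Proof.
move=> k0; set u := (_ ^-1).
have k2 : 1 <= k%:R ^+ 2 :> R by rewrite -natrX ler1n expn_gt0 k0.
have u0 : 0 <= u by rewrite invr_ge0; lra.
have u1 : u <= 1 by rewrite invf_le1; lra.
rewrite exprM -exprVn lerXn2r // ?nnegrE ?exprn_ge0 ?subr_ge0 //.
have bern : 2 <= (1 + u) ^+ (k ^ 2).
  have : 1 + u *+ (k ^ 2) <= (1 + u) ^+ (k ^ 2).
    elim: (k ^ 2)%N => [|n IH]; first by rewrite mulr0n addr0.
    rewrite exprS mulrSr; apply: (le_trans (y := (1 + u) * (1 + u *+ n))); last first.
      by rewrite ler_wpM2l //; lra.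
    have : 0 <= u * (u *+ n) by rewrite mulr_ge0 // mulrn_wge0.
    by lra.
  rewrite -[u *+ _]mulr_natr natrX mulVf; first by lra.
  by rewrite gt_eqF //; lra.
have : (1 - u) ^+ (k ^ 2) * (1 + u) ^+ (k ^ 2) <= 1.
  rewrite -exprMn (_ : (1 - u) * (1 + u) = 1 - u ^+ 2); last by ring.
  have uu : u ^+ 2 <= 1 by rewrite expr_le1.
  by rewrite exprn_ile1 //; have := sqr_ge0 u; lra.
have : 0 <= (1 - u) ^+ (k ^ 2) by rewrite exprn_ge0 //; lra.
move: ((1 - u) ^+ _) ((1 + u) ^+ _) bern => a b' bern a0 ab.
have : a * 2 <= a * b' by rewrite ler_wpM2l.
lra.
Qed.

Lemma detection_exponents (l K c : nat) : (2 <= K)%N -> c = (2 * l + 5)%N ->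
  (2 * (2 * K ^ (c + 2)).+1 ^ l < 2 ^ (K ^ c))%N.
Proof.
move=> K2 cE; have K0 : (0 < K)%N by apply: leq_trans K2.
apply: (@leq_ltn_trans (K ^ ((c + 4) * l + 1))).
  rewrite [((c + 4) * l + 1)%N]addnC (expnD K 1) expn1; apply: leq_mul => //.
  rewrite expnM; case: l cE => // l _; rewrite leq_exp2r //.
  apply: (leq_trans (n := (4 * K ^ (c + 2))%N)).
    have : (0 < K ^ (c + 2))%N by rewrite expn_gt0 K0.
    by lia.
  rewrite (_ : c + 4 = 2 + (c + 2))%N; last by lia.
  by rewrite (expnD K 2) leq_mul2r (leq_exp2_pexp (e := 2) K2) ?orbT.
apply: (@leq_ltn_trans (2 ^ (K * ((c + 4) * l + 1)))).
  by rewrite expnM leq_exp2r ?expn_bigger // addn1.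
rewrite ltn_exp2l // (_ : c = (2 * l + 4).+1); last by rewrite cE; lia.
rewrite expnS ltn_pmul2l //.
apply: (@leq_trans (2 ^ (2 * l + 4))); last first.
  by case: (2 * l + 4)%N => // n; rewrite leq_exp2r.
rewrite expnD mul2n -addnn expnD.
have := ltn_expl l (ltnSn 1); move: (2 ^ l)%N => w lw.
by rewrite -[(2 ^ 4)%N]/16%N; nia.
Qed.

(** At each [m] the product of kernels is exponentially small because one factor is, whereas the
    main term of [kernsum_ge] is only polynomially small in [K]. Hence some nonzero [h] has a large
    sum. *)
Lemma detection (l : nat) : exists c : nat, forall (K L : nat) (phi : nat -> nat -> R),
  (2 <= K)%N -> (0 < L)%N ->
  (forall m, (m < L)%N -> exists2 i, (i < l)%N & ~ nearint (K%:R^-1) (phi i m)) ->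
  exists h : nat -> int, [/\ forall i, (i < l)%N -> `|h i| <= (K ^ c)%:Z,
    exists2 i, (i < l)%N & h i != 0 &
    L%:R <= (K ^ c)%:R * `|csum (fun m => \sum_(i < l) (h i)%:~R * phi i m) L|].
Proof.
pose c2 := (2 * l + 5)%N; pose c := (l + 1 + (c2 + 4) * l)%N.
exists c => K L phi K2 L0 far.
have K0 : (0 < K)%N by apply: leq_trans K2.
have l0 : (0 < l)%N by have [i il _] := far 0%N L0; apply: leq_trans il.
have L0r : 0 < L%:R :> R by rewrite ltr0n.
(* [K ^ 2] factors bring [1 - 1 / K ^ 2] down to at most 1/2, and this is repeated [K ^ c2]
   times. *)
pose r := (K ^ (c2 + 2))%N.
have Kc0 : 0 < (K ^ c)%:R :> R by rewrite ltr0n expn_gt0 K0.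
have rc : (r <= K ^ c)%N.
  by rewrite leq_pexp2l // /c; move: l0; clear; nia.
apply: contrapT => no.
have small (h : nat -> int) : (forall i, (i < l)%N -> `|h i| <= r%:Z) ->
    (exists2 i, (i < l)%N & h i != 0) ->
    `|csum (fun m => \sum_(i < l) (h i)%:~R * phi i m) L| <= L%:R / (K ^ c)%:R.
  move=> hr h0; rewrite ler_pdivlMr // leNgt; apply/negP => lt; apply: no; exists h.
  split => //; last by rewrite mulrC ltW.
  by move=> i il; apply: (le_trans (hr i il)); rewrite lez_nat.
have lower := kernsum_ge (divr_ge0 (ltW L0r) (ltW Kc0)) small.
have upper : kernsum r L phi l (fun=> 0) <= L%:R * (2 ^+ (K ^ c2))^-1.
  rewrite /kernsum.
  have -> : L%:R * (2 ^+ (K ^ c2))^-1 = \sum_(m < L) (2 ^+ (K ^ c2))^-1 :> R.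
    by rewrite sumr_const card_ord mulr_natl.
  apply: ler_sum => m _; rewrite mulr0 cos0 mul1r.
  have [i il ni] := far m (ltn_ord m).
  have kernE x : kern r x = (cos (pi * x) ^+ 2) ^+ r by rewrite /kern exprM.
  have k01 (x : R) : 0 <= kern r x <= 1.
    rewrite kernE exprn_ge0 ?sqr_ge0 //=; apply: exprn_ile1; first exact: sqr_ge0.
    by rewrite cos2sin2 gerBl sqr_ge0.
  rewrite (bigD1 (Ordinal il)) //=.
  apply: (@le_trans _ _ (kern r (phi i m))).
    have /andP[k0 _] := k01 (phi i m).
    rewrite ler_piMr //; apply: prodr_ile1 => j _; exact: k01.
  rewrite kernE; have e0 : 0 <= K%:R^-1 :> R by rewrite invr_ge0 ler0n.
  apply: (le_trans (lerXn2r r _ _ (not_nearint_cos2 e0 ni))).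
  - by rewrite nnegrE sqr_ge0.
  - by rewrite nnegrE subr_ge0 exprn_ile1 // invf_le1 ?ler1n // ltr0n.
  by rewrite exprVn /r addnC expnD; apply: one_sub_pow_le.
have bexp := @detection_exponents l K c2 K2 erefl; rewrite -/r in bexp.
set w := ((2 * r).+1 ^ l)%N in bexp.
have w0 : 0 < w%:R :> R by rewrite ltr0n expn_gt0.
have pkr : w%:R^-1 <= pk R r r ^+ l.
  rewrite /w natrX -exprVn lerXn2r ?nnegrE ?invr_ge0 ?ler0n ?pk_ge0 //.
  rewrite /pk ler_pdivlMr ?exprn_gt0 // mulrC ler_pdivrMr ?ltr0n //.
  rewrite exprM -natrX -[4]/(4%:R) -!natrX -natrM ler_nat mulnC.
  exact: central_binomial_ge.
have lK : l%:R * (L%:R / (K ^ c)%:R) <= L%:R * (2^-1 * w%:R^-1) :> R.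
  rewrite mulrCA ler_wpM2l ?ler0n // ler_pdivrMr // -invfM mulrC ler_pdivlMr ?mulr_gt0 //.
  rewrite -[2]/(2%:R) -!natrM ler_nat /c expnD expnD expn1.
  apply: leq_trans (_ : (K ^ l * (K * w) <= _)%N); first apply: leq_mul.
  - by apply: leq_exp2_pexp => //; apply: expn_bigger.
  - by rewrite leq_mul2r K2 orbT.
  rewrite mulnA leq_mul2l; apply/orP; right.
  rewrite /w expnM leq_exp2r // /r.
  apply: (leq_trans (n := (4 * K ^ (c2 + 2))%N)).
    have : (0 < K ^ (c2 + 2))%N by rewrite expn_gt0 K0.
    by clear; lia.
  rewrite (_ : c2 + 4 = 2 + (c2 + 2))%N; last by lia.
  by rewrite (expnD K 2) leq_mul2r (leq_exp2_pexp (e := 2) K2) ?orbT.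
have h1 : w%:R^-1 * L%:R <= pk R r r ^+ l * L%:R by rewrite ler_wpM2r ?ler0n.
have h2 : L%:R * (2 ^+ (K ^ c2))^-1 < L%:R * (2^-1 * w%:R^-1) :> R.
  rewrite ltr_pM2l // -invfM ltf_pV2 ?posrE ?exprn_gt0 ?mulr_gt0 //.
  by rewrite -[2]/(2%:R) -natrX -natrM ltr_nat.
lra.
Qed.

End Detection.

(** * Taylor expansion of real powers *)

Section Taylor.
Variable R : realType.
Implicit Types th y : R.

(** The generalized binomial coefficient [th] over [j]. *)
Definition gbin th (j : nat) : R := \prod_(i < j) ((th - i%:R) / i.+1%:R).

Lemma gbin0 th : gbin th 0 = 1.
Proof. by rewrite /gbin big_ord0. Qed.

Lemma gbinS th j : j.+1%:R * gbin th j.+1 = (th - j%:R) * gbin th j.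
Proof. by rewrite /gbin big_ord_recr /=; field; rewrite nat1r pnatr_eq0. Qed.

Lemma gbin_absorb th j : j.+1%:R * gbin th j.+1 = th * gbin (th - 1) j.
Proof.
elim: j => [|j IH]; first by rewrite gbinS !gbin0 subr0.
rewrite gbinS; apply: (mulfI (_ : j.+1%:R != 0)); first by rewrite pnatr_eq0.
rewrite mulrCA IH [RHS]mulrCA gbinS -[j.+1%:R]natr1; ring.
Qed.

Lemma gbin_neq0 th j : (forall z : int, th != z%:~R) -> gbin th j != 0.
Proof.
move=> H; apply/prodf_neq0 => i _; rewrite mulf_neq0 ?invr_eq0 ?pnatr_eq0 //.
by rewrite subr_eq0; apply: H i%:Z.
Qed.

(** The Taylor polynomial of [y ^ th] at [y = 1], with [D] terms. *)
Definition taypoly th (D : nat) y : R := \sum_(j < D) gbin th j * (y - 1) ^+ j.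

Lemma is_derive_taypoly th D y :
  is_derive y 1 (taypoly th D.+1) (th * taypoly (th - 1) D y).
Proof.
elim: D => [|D IH].
  have -> : taypoly th 1 = cst 1.
    by apply: funext => x; rewrite /taypoly big_ord1 gbin0 expr0 mulr1.
  by rewrite /taypoly big_ord0 mulr0; apply: is_derive_cst.
have -> : taypoly th D.+2 = taypoly th D.+1 + gbin th D.+1 \*: ((id - cst 1) ^+ D.+1).
  apply: funext => x; rewrite /taypoly big_ord_recr /=; congr (_ + _).
  by rewrite -[RHS]/(gbin th D.+1 * ((((id : R -> R) - cst 1) ^+ D.+1) x)) exprfctE.
apply: is_derive_eq.
rewrite subr0 /= {2}/taypoly big_ord_recr /= -/(taypoly (th - 1) D y) mulrDr; congr (_ + _).
rewrite mulrA -gbin_absorb /GRing.scale /= mulr1; ring.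
Qed.

(** The derivative of the remainder for [th] with [D + 1] terms is [th] times the remainder for
    [th - 1] with [D] terms, so the mean value theorem carries the induction. *)
Lemma taylor_powR (D : nat) th : exists2 C : R, 0 <= C &
  forall y, 1 <= y <= 2 -> `|y `^ th - taypoly th D y| <= C * (y - 1) ^+ D.
Proof.
elim: D th => [|D IH] th.
  exists (2 `^ `|th|); first exact: powR_ge0.
  move=> y /andP[y1 y2]; rewrite /taypoly big_ord0 subr0 expr0 mulr1 ger0_norm ?powR_ge0 //.
  apply: (@le_trans _ _ (y `^ `|th|)); first by rewrite ler_powR // ler_norm.
  by rewrite ge0_ler_powR // nnegrE; lra.
have [C C0 HC] := IH (th - 1).
exists (`|th| * C); first by rewrite mulr_ge0.
move=> y /andP[y1 y2].
pose f : R -> R := (fun x => x `^ th) - taypoly th D.+1.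
pose df x := th * (x `^ (th - 1) - taypoly (th - 1) D x).
have dv (x : R) : 0 < x -> is_derive x 1 f (df x).
  move=> x0; rewrite /df mulrBr; apply: is_deriveB; last exact: is_derive_taypoly.
  exact: is_derive1_powR.
have [||c] := @MVT_segment R f df 1 y y1.
- by move=> x; rewrite in_itv /= => /andP[x1 _]; apply: dv; lra.
- apply: derivable_within_continuous => x; rewrite in_itv /= => /andP[x1 _].
  by have [] := dv x ltac:(lra).
rewrite in_itv /= => /andP[c1 cy].
have f1 : f 1 = 0.
  have -> : f 1 = 1 `^ th - taypoly th D.+1 1 by [].
  rewrite powR1 /taypoly big_ord_recl /= gbin0 subrr expr0 mulr1.
  by rewrite big1 ?addr0 ?subrr // => i _; rewrite expr0n mulr0.
rewrite f1 subr0 => fy; have -> : y `^ th - taypoly th D.+1 y = f y by [].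
rewrite fy /df !normrM (ger0_norm (_ : 0 <= y - 1)) ?subr_ge0 // -!mulrA exprSr.
rewrite ler_wpM2l // mulrA ler_wpM2r ?subr_ge0 //.
apply: (le_trans (HC c _)); first by rewrite c1 (le_trans cy).
by rewrite ler_wpM2l // lerXn2r // ?nnegrE; lra.
Qed.

Lemma taylor_powR_scaled (D : nat) th : exists2 C : R, 0 <= C &
  forall (M m : nat), (0 < M)%N -> (m <= M)%N ->
  `|(M + m)%:R `^ th - \sum_(j < D) (gbin th j * M%:R `^ th / M%:R ^+ j) * m%:R ^+ j|
    <= C * M%:R `^ th * (m%:R / M%:R) ^+ D.
Proof.
have [C C0 HC] := taylor_powR D th; exists C => // M m M0 mM.
have M0r : 0 < M%:R :> R by rewrite ltr0n.
have x01 : 0 <= (m%:R / M%:R : R) <= 1.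
  by rewrite divr_ge0 ?ler0n //= ler_pdivrMr // mul1r ler_nat.
have := HC (m%:R / M%:R + 1) ltac:(lra); rewrite addrK => H.
have -> : (M + m)%:R `^ th = M%:R `^ th * (m%:R / M%:R + 1) `^ th.
  have x1 : 0 <= (m%:R / M%:R + 1 : R) by lra.
  rewrite -(powRM th (ler0n _ _) x1).
  by rewrite mulrDr mulrC divfK ?gt_eqF // mulr1 natrD addrC.
have -> : \sum_(j < D) (gbin th j * M%:R `^ th / M%:R ^+ j) * m%:R ^+ j =
    M%:R `^ th * taypoly th D (m%:R / M%:R + 1).
  rewrite /taypoly mulr_sumr addrK; apply: eq_bigr => j _.
  by rewrite expr_div_n; ring.
rewrite -mulrBr normrM ger0_norm ?powR_ge0 // (mulrC C) -mulrA.
by rewrite ler_wpM2l ?powR_ge0.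
Qed.

(* Induction on [ts]: by [gbinS], the combination [j.+1 * u j.+1 - (t - j) * u j] of two
   consecutive relations no longer involves [t]. *)
Lemma gbin_solve (ts : seq R) (th0 : R) (t0 : nat) :
  th0 \notin ts -> (forall z : int, th0 != z%:~R) ->
  exists2 C : R, 0 <= C & forall (b : R -> R) (Y : R),
    (forall j, (t0 <= j <= t0 + size ts)%N ->
      `|gbin th0 j * b th0 + \sum_(t <- ts) gbin t j * b t| <= Y) ->
    `|b th0| <= C * Y.
Proof.
elim: ts => [|t ts IH] nin nint.
  exists (`|gbin th0 t0|^-1); first by rewrite invr_ge0.
  move=> b Y H; have := H t0; rewrite addn0 leqnn => /(_ isT).
  by rewrite big_nil addr0 normrM mulrC -ler_pdivlMr ?normr_gt0 ?gbin_neq0 // mulrC.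
move: nin; rewrite inE negb_or => /andP[neq nin].
have [C C0 HC] := IH nin nint.
pose C1 : R := 2 * (t0 + size ts).+1%:R + `|t|.
have C10 : 0 <= C1 by rewrite addr_ge0 // mulr_ge0 ?ler0n.
exists (`|th0 - t|^-1 * (C * C1)); first by rewrite !mulr_ge0 ?invr_ge0.
move=> b Y H.
have Y0 : 0 <= Y by apply: le_trans (H t0 _); rewrite // leqnn leq_addr.
rewrite -mulrA -mulrA mulrC ler_pdivlMr ?normr_gt0 ?subr_eq0 // mulrC -normrM.
apply: (HC (fun th => (th - t) * b th)) => j /andP[j0 js].
pose u i := gbin th0 i * b th0 + \sum_(th <- t :: ts) gbin th i * b th.
have -> : gbin th0 j * ((th0 - t) * b th0) + \sum_(th <- ts) gbin th j * ((th - t) * b th)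
    = j.+1%:R * u j.+1 - (t - j%:R) * u j.
  rewrite /u !mulrDr opprD addrACA !mulr_sumr -sumrB.
  have E th : j.+1%:R * (gbin th j.+1 * b th) - (t - j%:R) * (gbin th j * b th) =
      gbin th j * ((th - t) * b th) by rewrite mulrA gbinS; ring.
  rewrite E; congr (_ + _); rewrite [RHS]big_cons E subrr mul0r mulr0 add0r.
  by apply: eq_bigr => th _; rewrite E.
apply: (le_trans (ler_normB _ _)).
rewrite !normrM normr_nat.
have h1 : `|u j.+1| <= Y by apply: H => /=; move: j0 js; clear; lia.
have h2 : `|u j| <= Y by apply: H => /=; move: j0 js; clear; lia.
have h3 : `|t - j%:R| <= `|t| + (t0 + size ts).+1%:R.
  apply: (le_trans (ler_normB _ _)); rewrite normr_nat lerD2l ler_nat.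
  by move: js; clear; lia.
have h4 : j.+1%:R <= (t0 + size ts).+1%:R :> R by rewrite ler_nat ltnS.
apply: (@le_trans _ _ ((t0 + size ts).+1%:R * Y + (`|t| + (t0 + size ts).+1%:R) * Y)).
  by apply: lerD; apply: ler_pM.
by rewrite /C1; lra.
Qed.

End Taylor.

(** * Major arcs *)

Section GeneralizedForms.
Variable R : realType.
Implicit Types (a : nat -> R) (b tau : R -> R) (Th : seq R).

(** Letting the constant [tau] depend on the exponent keeps this class stable under the rescaling in
    [gform_scale]. *)
Definition gform (d : nat) Th a b tau (n : nat) : R :=
  \sum_(t < d.+1) a t * n%:R ^+ t + \sum_(th <- Th) b th * (n%:R `^ th - tau th).

(* The coefficients of [m |-> \sum_(t < d.+1) a t * (M + m) ^+ t]. *)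
Definition shifted_coef (d : nat) a (M j : nat) : R :=
  \sum_(t < d.+1) a t * ('C(t, j) * M ^ (t - j))%:R.

(** The coefficient of [m ^ j] in the expansion of [gform] at [M + m]. The shifts [tau] enter only
    for [j = 0], which [weyl_inverse] does not touch. *)
Definition taylor_coef (d : nat) Th a b tau (M j : nat) : R :=
  shifted_coef d a M j + (\sum_(th <- Th) gbin th j * (b th * M%:R `^ th)) / M%:R ^+ j
  - (if j == 0%N then \sum_(th <- Th) b th * tau th else 0).

(** Finitely many bounds, monotone in [e], are merged by a maximum; this makes exponents uniform
    over [Th]. *)
Lemma seq_bound (T : eqType) (s : seq T) (P : T -> nat -> Prop) :
  {in s, forall x, exists e, P x e} ->
  (forall x e e', (e <= e')%N -> P x e -> P x e') ->
  exists e, {in s, forall x, P x e}.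
Proof.
move=> H mono; elim: s H => [|x s IH] H; first by exists 0%N.
have [e1 He1] := H x (mem_head _ _).
have [|e2 He2] := IH; first by move=> y ys; apply: H; rewrite inE ys orbT.
exists (maxn e1 e2) => y; rewrite inE => /predU1P[->|ys].
  by apply: mono He1; apply: leq_maxl.
by apply: mono (He2 y ys); apply: leq_maxr.
Qed.

Lemma exists_exp2_ge (C : R) : exists e : nat, C <= (2 ^ e)%:R.
Proof.
exists (Num.bound `|C|); apply: (@le_trans _ _ (Num.bound `|C|)%:R).
  by apply: le_trans (ler_norm C) (ltW _); apply: archi_boundP.
by rewrite ler_nat expn_bigger.
Qed.

Lemma gbin_le (S : nat) (th : R) j : 1 <= th <= S%:R -> `|gbin th j| <= (S.+1 ^ j)%:R.
Proof.
move=> /andP[th1 thS]; elim: j => [|j IH]; first by rewrite gbin0 normr1.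
rewrite /gbin big_ord_recr /= -/(gbin th j) normrM expnSr natrM; apply: ler_pM => //.
rewrite normrM normfV normr_nat ler_pdivrMr ?ltr0n //.
apply: (@le_trans _ _ (S%:R + j%:R)).
  by apply: (le_trans (ler_normB _ _)); rewrite normr_nat ger0_norm; lra.
by rewrite -natrD -natrM ler_nat; nia.
Qed.

Lemma polynomial_shift d D a (M m : nat) : (d < D)%N ->
  \sum_(t < d.+1) a t * (M + m)%:R ^+ t = \sum_(j < D) shifted_coef d a M j * m%:R ^+ j.
Proof.
move=> dD; rewrite /shifted_coef.
under [RHS]eq_bigr => j _ do rewrite mulr_suml.
rewrite exchange_big /=; apply: eq_bigr => t _.
rewrite natrD exprDn mulr_sumr (big_ord_widen D (fun i => a t * (M%:R ^+ (t - i) * m%:R ^+ i *+ 'C(t, i)))); last first.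
  by apply: leq_trans dD.
rewrite [LHS]big_mkcond /=; apply: eq_bigr => j _; rewrite ltnS.
case: leqP => jt; last by rewrite bin_small // mul0n mulr0 mul0r.
by rewrite natrM natrX -mulr_natr; ring.
Qed.

Lemma gform_taylor (Th : seq R) (D : nat) : exists e : nat,
  forall d a b tau (M m : nat), (d < D)%N -> (0 < M)%N -> (m <= M)%N ->
  `|gform d Th a b tau (M + m) - \sum_(j < D) taylor_coef d Th a b tau M j * m%:R ^+ j|
  <= \sum_(th <- Th) `|b th| * ((2 ^ e)%:R * M%:R `^ th * (m%:R / M%:R) ^+ D).
Proof.
have [e He] : exists e : nat, {in Th, forall th, forall (M m : nat), (0 < M)%N -> (m <= M)%N ->
  `|(M + m)%:R `^ th - \sum_(j < D) (gbin th j * M%:R `^ th / M%:R ^+ j) * m%:R ^+ j|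
    <= (2 ^ e)%:R * M%:R `^ th * (m%:R / M%:R) ^+ D}.
  apply: (seq_bound (P := fun th e => forall (M m : nat), (0 < M)%N -> (m <= M)%N ->
    `|(M + m)%:R `^ th - \sum_(j < D) (gbin th j * M%:R `^ th / M%:R ^+ j) * m%:R ^+ j|
    <= (2 ^ e)%:R * M%:R `^ th * (m%:R / M%:R) ^+ D)).
    move=> th _; have [C C0 HC] := taylor_powR_scaled D th.
    have [e Ce] := exists_exp2_ge C; exists e => M m M0 mM.
    apply: (le_trans (HC M m M0 mM)).
    by rewrite !ler_wpM2r ?powR_ge0 ?exprn_ge0 ?divr_ge0 ?ler0n.
  move=> th e e' le H M m M0 mM; apply: (le_trans (H M m M0 mM)).
  by rewrite !ler_wpM2r ?powR_ge0 ?exprn_ge0 ?divr_ge0 ?ler0n // ler_pexpK.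
exists e => d a b tau M m dD M0 mM.
have D0 : (0 < D)%N by apply: leq_trans dD.
have -> : \sum_(j < D) taylor_coef d Th a b tau M j * m%:R ^+ j =
  \sum_(j < D) shifted_coef d a M j * m%:R ^+ j +
  (\sum_(th <- Th) b th * (\sum_(j < D) (gbin th j * M%:R `^ th / M%:R ^+ j) * m%:R ^+ j)
   - \sum_(th <- Th) b th * tau th).
  rewrite /taylor_coef.
  under eq_bigr => j _ do rewrite !mulrDl -addrA.
  rewrite big_split /= big_split /=; congr (_ + (_ + _)).
    under [RHS]eq_bigr => th _ do rewrite mulr_sumr.
    rewrite [RHS]exchange_big /=; apply: eq_bigr => j _.
    by rewrite !mulr_suml; apply: eq_bigr => th _; ring.
  rewrite (bigD1 (Ordinal D0)) //= expr0 mulr1 [X in _ + X]big1 ?addr0 // => j /eqP jn.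
  case: eqP => [E|_]; last by rewrite oppr0 mul0r.
  by case: jn; apply: val_inj.
rewrite /gform (polynomial_shift a M m dD) opprD addrACA subrr add0r.
rewrite opprD opprK -sumrN.
have -> : \sum_(th <- Th) b th * ((M + m)%:R `^ th - tau th) =
   \sum_(th <- Th) b th * (M + m)%:R `^ th - \sum_(th <- Th) b th * tau th.
  by rewrite -sumrB; apply: eq_bigr => th _; rewrite mulrBr.
rewrite addrACA [X in _ + X]addrC subrr addr0 -big_split /=.
apply: (le_trans (ler_norm_sum _ _ _)).
rewrite [X in X <= _]big_seq [X in _ <= X]big_seq; apply: ler_sum => th thT.
by rewrite -mulrBr normrM ler_wpM2l //; apply: He.
Qed.

Lemma bin_le_exp2 n m : ('C(n, m) <= 2 ^ n)%N.
Proof.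
elim: n m => [|n IH] [|m] //; first by rewrite bin0 expn_gt0.
by rewrite binS expnS mul2n -addnn leq_add.
Qed.

(** The map from [a] to its shifted coefficients is triangular with integer entries and ones on the
    diagonal, so it is inverted from degree [d] down. The factors [M ^ (t - j)] match the scales
    [M ^ j] of the errors, and each degree costs one factor [c]. *)
Lemma shifted_coef_descent d a (q M c : nat) (X : R) : (0 < M)%N -> 0 <= X ->
  (1 + d.+1 * 2 ^ d <= c)%N ->
  (forall j, (1 <= j <= d)%N -> nearint (X / M%:R ^+ j) (q%:R * shifted_coef d a M j)) ->
  forall j, (1 <= j <= d)%N -> nearint (c%:R ^+ d * X / M%:R ^+ j) (q%:R * a j).
Proof.
move=> M0 X0 cd H.
have M0r : 0 < M%:R :> R by rewrite ltr0n.
have c1 : 1 <= c%:R :> R by rewrite ler1n; apply: leq_trans cd.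
suff S i : (i < d)%N -> nearint (c%:R ^+ i.+1 * X / M%:R ^+ (d - i)) (q%:R * a (d - i)%N).
  move=> j /andP[j1 jd]; have := S (d - j)%N; rewrite subKn // => /(_ _) HS.
  apply: nearint_le (HS _); last by move: j1 jd; clear; lia.
  rewrite ler_wpM2r ?invr_ge0 ?exprn_ge0 ?ler0n // ler_wpM2r //.
  by rewrite ler_weXn2l //; move: j1 jd; clear; lia.
elim/ltn_ind: i => i IH id.
pose j := (d - i)%N; have j1 : (1 <= j <= d)%N by rewrite /j; move: id; clear; lia.
have jd : (j < d.+1)%N by case/andP: j1.
rewrite -/j.
have E : q%:R * a j = q%:R * shifted_coef d a M j
   - \sum_(t < d.+1 | (j < t)%N) ('C(t, j) * M ^ (t - j))%:R * (q%:R * a t).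
  rewrite /shifted_coef (bigD1 (Ordinal jd)) //= binn subnn muln1 mulr1 mulrDr.
  rewrite -addrA -[LHS]addr0; congr (_ + _); apply/esym/eqP; rewrite subr_eq0; apply/eqP.
  rewrite mulr_sumr (bigID (fun t : 'I_d.+1 => (j < t)%N)) /= [X in _ + X]big1; last first.
    move=> t /andP[/eqP tj]; rewrite -leqNgt leq_eqVlt => /orP[/eqP E|tj'].
      by case: tj; apply: val_inj.
    by rewrite bin_small // mul0n mulr0 mulr0.
  rewrite addr0; apply: eq_big => [t|t _]; last by ring.
  by apply: andb_idl => jt; apply/eqP => /(congr1 val) /= E; move: jt; rewrite E ltnn.
rewrite E.
pose B : R := c%:R ^+ i * X / M%:R ^+ j.
have nearsum : nearint (\sum_(t < d.+1 | (j < t)%N) (2 ^ d)%:R * B)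
    (\sum_(t < d.+1 | (j < t)%N) ('C(t, j) * M ^ (t - j))%:R * (q%:R * a t)).
  apply: nearint_sum => t jt.
  have := IH (d - t)%N _ _; rewrite subKn; last by rewrite -ltnS.
  move=> near; apply: nearint_le (nearintMn _ (near _ _)).
  - rewrite /B natrM -mulrA; apply: ler_pM; rewrite ?ler0n //.
      by rewrite mulr_ge0 ?ler0n // divr_ge0 ?exprn_ge0 ?ler0n // mulr_ge0 // exprn_ge0 ?ler0n.
      by rewrite ler_nat; apply: (leq_trans (bin_le_exp2 _ _)); rewrite leq_pexp2l // -ltnS.
    rewrite natrX; apply: (@le_trans _ _ (M%:R ^+ (t - j) * (c%:R ^+ i * X / M%:R ^+ t))).
      rewrite ler_wpM2l ?exprn_ge0 ?ler0n // ler_wpM2r ?invr_ge0 ?exprn_ge0 ?ler0n //.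
      by rewrite ler_wpM2r // ler_weXn2l //; rewrite /j in jt; move: jt (ltn_ord t) id; clear; lia.
    have Mt : M%:R ^+ t = M%:R ^+ (t - j) * M%:R ^+ j :> R by rewrite -exprD subnK // ltnW.
    rewrite Mt le_eqVlt; apply/orP; left; apply/eqP.
    move: (exprn_gt0 (t - j) M0r) (exprn_gt0 j M0r).
    move: (_ ^+ (t - j)) (_ ^+ j) => u v u0 v0.
    by field; rewrite !gt_eqF.
  - by rewrite /j in jt *; move: jt (ltn_ord t) id; clear; lia.
  - by move: j1 jt (ltn_ord t); clear; lia.
apply: nearint_le (nearintB (H j j1) nearsum).
have B0 : 0 <= B.
  by rewrite divr_ge0 ?exprn_ge0 ?ler0n // mulr_ge0 // exprn_ge0 ?ler0n.
have XB : X / M%:R ^+ j <= B.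
  rewrite ler_wpM2r ?invr_ge0 ?exprn_ge0 ?ler0n // ler_peMl //.
  by rewrite exprn_ege1.
apply: (@le_trans _ _ (B + d.+1%:R * ((2 ^ d)%:R * B))).
  apply: lerD => //; rewrite sumr_const -[X in X <= _]mulr_natl ler_wpM2r //.
    by rewrite mulr_ge0 ?ler0n.
  by rewrite ler_nat -[X in (_ <= X)%N]card_ord; apply: max_card.
have -> : c%:R ^+ i.+1 * X / M%:R ^+ j = c%:R * B by rewrite exprS /B -!mulrA.
have -> : B + d.+1%:R * ((2 ^ d)%:R * B) = (1 + d.+1 * 2 ^ d)%:R * B.
  by rewrite natrD natrM mulrDl mul1r -!mulrA.
by rewrite ler_wpM2r // ler_nat.
Qed.

End GeneralizedForms.

Section MajorArcs.
Variable R : realType.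
Implicit Types (a : nat -> R) (b tau : R -> R) (Th : seq R).

Lemma gbin_solve_uniform Th (t0 : nat) :
  uniq Th -> {in Th, forall th, forall z : int, th != z%:~R} ->
  exists e : nat, {in Th, forall th0, forall (b : R -> R) (Y : R),
    (forall j, (t0 <= j <= t0 + size Th)%N -> `|\sum_(th <- Th) gbin th j * b th| <= Y) ->
    `|b th0| <= (2 ^ e)%:R * Y}.
Proof.
move=> uTh nint.
apply: (seq_bound (P := fun th0 e => forall (b : R -> R) (Y : R),
    (forall j, (t0 <= j <= t0 + size Th)%N -> `|\sum_(th <- Th) gbin th j * b th| <= Y) ->
    `|b th0| <= (2 ^ e)%:R * Y)).
  move=> th0 th0T.
  have nin : th0 \notin rem th0 Th by rewrite mem_rem_uniq // inE eqxx.
  have [C C0 HC] := @gbin_solve R (rem th0 Th) th0 t0 nin (nint th0 th0T).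
  have [e Ce] := exists_exp2_ge C; exists e => b Y H.
  have Y0 : 0 <= Y by apply: le_trans (H t0 _); rewrite // leqnn leq_addr.
  apply: (@le_trans _ _ (C * Y)); last by rewrite ler_wpM2r.
  apply: HC => j /andP[j0 js]; have := H j; rewrite (big_rem th0) //=; apply.
  rewrite j0 /=; apply: (leq_trans js); rewrite leq_add2l size_rem //.
  exact: leq_pred.
move=> th e e' le H b Y HY.
have Y0 : 0 <= Y by apply: le_trans (HY t0 _); rewrite // leqnn leq_addr.
by apply: (le_trans (H b Y HY)); rewrite ler_wpM2r // ler_pexpK.
Qed.

Lemma sum_seq_le (s : seq R) (F : R -> R) (B : R) :
  {in s, forall x, `|F x| <= B} -> `|\sum_(x <- s) F x| <= (size s)%:R * B.
Proof.
move=> H; apply: (le_trans (ler_norm_sum _ _ _)).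
have -> : (size s)%:R * B = \sum_(x <- s) B.
  by rewrite big_const_seq count_predT iter_addr_0 mulr_natl.
by rewrite big_seq [X in _ <= X]big_seq; apply: ler_sum => x /H.
Qed.

(** One [q] serves all Taylor coefficients: those of high order determine the sizes of the [b th],
    whose contribution is then subtracted from those of low order. *)
Lemma major_arcs d Th (S : nat) : uniq Th ->
  {in Th, forall th, 1 <= th <= S%:R} -> {in Th, forall th, forall z : int, th != z%:~R} ->
  exists t1 E : nat, forall (J W : nat) a b tau, (2 <= J)%N -> (J ^ E <= W)%N ->
  {in Th, forall th, `|b th| <= J%:R} ->
  (W ^ t1)%:R <= J%:R *
     `|csum (fun m => gform d Th a b tau (W ^ t1.+1 + m)) (W ^ t1)| ->
  exists q, [/\ (1 <= q <= J ^ E)%N,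
    forall t, (1 <= t <= d)%N ->
      nearint ((J ^ E * W ^ t1)%:R / (W ^ t1.+1)%:R ^+ t) (q%:R * a t) &
    {in Th, forall th, `|b th| * (W ^ t1.+1)%:R `^ th <= (J ^ E * W ^ t1)%:R}].
Proof.
move=> uTh ThS nint.
(* Orders [j >= t0] exceed [d], so the polynomial part vanishes there, and exceed [S], so
   [M ^ S / M ^ j <= 1 / W]. Up to [t1] there are [size Th + 1] consecutive orders, as
   [gbin_solve_uniform] requires. *)
pose t0 := (d + S).+1; pose sz := size Th; pose t1 := (t0 + sz)%N.
(* The Taylor error has order [M ^ S * (L / M) ^ D1.+1], up to the sizes of the [b th]; since
   [L / M = 1 / W], this [D1] brings it below [1 / W]. *)
pose D1 := (t1.+1 * S.+1)%N.
have [e He] := gform_taylor Th D1.+1.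
have [E0 weyl] := weyl_inverse R D1.
have [e1 He1] := gbin_solve_uniform t0 uTh nint.
pose g := (S.+1 ^ t1)%N; pose c := (1 + d.+1 * 2 ^ d)%N.
pose E := (4 * E0 + e + e1 + sz + S.+1 * t1 + (2 * d + 2) * d + 20)%N.
exists t1, E => J W a b tau J2 JW bJ.
set M := (W ^ t1.+1)%N; set L := (W ^ t1)%N => big.
have J0 : (0 < J)%N by apply: leq_trans J2.
have W0 : (0 < W)%N by apply: leq_trans JW; rewrite expn_gt0 J0.
have M0 : (0 < M)%N by rewrite expn_gt0 W0.
have L0 : (0 < L)%N by rewrite expn_gt0 W0.
have J0r : 0 < J%:R :> R by rewrite ltr0n.
have W0r : 0 < W%:R :> R by rewrite ltr0n.
have M0r : 0 < M%:R :> R by rewrite ltr0n.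
have L0r : 0 < L%:R :> R by rewrite ltr0n.
have M1r : 1 <= M%:R :> R by rewrite ler1n.
have ML : (M = W * L)%N by rewrite /M /L expnS.
have MS th : th \in Th -> M%:R `^ th <= M%:R ^+ S.
  move=> /ThS /andP[_ thS]; rewrite -powR_mulrn ?ler0n //; exact: ler_powR.
have JE x : (x <= E)%N -> (J ^ x <= W)%N.
  by move=> xE; apply: leq_trans JW; rewrite leq_pexp2l.
have szJ : (sz <= J ^ sz)%N by apply: leq_exp2_pexp => //; apply: expn_bigger.
have gJ : (g <= J ^ (S.+1 * t1))%N.
  rewrite /g expnM; case: (t1) => // t; rewrite leq_exp2r //.
  by apply: leq_exp2_pexp => //; apply: expn_bigger.
have eJ x : (2 ^ x <= J ^ x)%N by apply: leq_exp2_pexp.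
pose P := fun m : nat => \sum_(j < D1.+1) taylor_coef d Th a b tau M j * m%:R ^+ j.
have dD : (d < D1.+1)%N.
  rewrite ltnS /D1 /t1 /t0; apply: (leq_trans (n := (t0 + sz).+1)); last by rewrite leq_pmulr.
  by rewrite /t0; lia.
have rem m : (m < L)%N -> `|gform d Th a b tau (M + m) - P m| <= (16 * J)%:R^-1.
  move=> mL; apply: (le_trans (He d a b tau M m dD M0 _)).
    by apply: (leq_trans (ltnW mL)); rewrite ML leq_pmull.
  apply: (@le_trans _ _ (sz%:R * (J%:R * ((2 ^ e)%:R * W%:R^-1)))).
    apply: le_trans (ler_norm _) _; apply: sum_seq_le => th thT.
    have nn : 0 <= (2 ^ e)%:R * M%:R `^ th * (m%:R / M%:R) ^+ D1.+1 :> R.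
      apply: mulr_ge0; first by rewrite mulr_ge0 ?powR_ge0 ?ler0n.
      by rewrite exprn_ge0 // divr_ge0 ?ler0n.
    rewrite ger0_norm; last by rewrite mulr_ge0.
    apply: ler_pM; rewrite ?bJ //.
    rewrite -mulrA ler_wpM2l ?ler0n //.
    apply: (@le_trans _ _ (M%:R ^+ S * (W%:R^-1) ^+ D1.+1)).
      apply: ler_pM; rewrite ?powR_ge0 ?exprn_ge0 ?divr_ge0 ?ler0n ?MS //.
      rewrite lerXn2r ?nnegrE ?divr_ge0 ?invr_ge0 ?ler0n // ler_pdivrMr // ML natrM mulrA.
      by rewrite mulVf ?gt_eqF // mul1r ler_nat ltnW.
    rewrite /M natrX -exprM exprVn exprSr invfM mulrA ler_piMl ?invr_ge0 ?ler0n //.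
    rewrite ler_pdivrMr ?exprn_gt0 // mul1r ler_weXn2l ?ler1n //.
    by rewrite /D1 mulnS; apply: leq_addl.
  rewrite !mulrA ler_pdivrMr // [X in _ <= X]mulrC ler_pdivlMr ?ltr0n ?muln_gt0 ?J0 //.
  rewrite -!natrM ler_nat; apply: leq_trans (JE (sz + 1 + e + (4 + 1))%N _).
    rewrite !expnD !expn1; apply: leq_mul; first apply: leq_mul; rewrite ?eJ //.
      by rewrite leq_mul2r szJ orbT.
    by rewrite leq_mul2r (eJ 4) orbT.
  by rewrite /E; clear; lia.
have big2 : L%:R <= (J ^ 2)%:R * `|csum P L|.
  have dist : `|csum (fun m => gform d Th a b tau (M + m)) L - csum P L|
      <= L%:R * (8 * (16 * J)%:R^-1).
    by apply: csum_dist => m mL; apply: cos_nearint; apply: nearint_small; apply: rem.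
  move: big dist; set A := csum _ L; set B := csum P L => bigA dAB.
  have E8 : 8 * (16 * J)%:R^-1 = (2 * J%:R)^-1 :> R.
    by rewrite natrM; field; rewrite gt_eqF.
  rewrite E8 in dAB.
  have tri : `|A| <= `|A - B| + `|B|.
    by rewrite -[X in `|X| <= _](subrK B); apply: ler_normD.
  have h1 : 2 * J%:R * `|A - B| <= L%:R.
    apply: (@le_trans _ _ (2 * J%:R * (L%:R / (2 * J%:R)))).
      by rewrite ler_wpM2l // mulr_ge0 ?ler0n.
    by rewrite mulrC divfK // gt_eqF //; lra.
  have h2 : 2 * J%:R * `|A| <= 2 * J%:R * (`|A - B| + `|B|).
    by rewrite ler_wpM2l // mulr_ge0 ?ler0n.
  have h3 : 2 * J%:R <= (J ^ 2)%:R :> R.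
    by rewrite -[2]/(2%:R) -natrM ler_nat expnS expn1 leq_mul2r J2 orbT.
  have : 2 * J%:R * `|B| <= (J ^ 2)%:R * `|B| by rewrite ler_wpM2r.
  by lra.
have JJ2 : (2 <= J ^ 2)%N by apply: (leq_trans J2); rewrite -[X in (X <= _)%N]expn1 leq_pexp2l.
have [q [/andP[q1 qE] near]] := weyl (J ^ 2)%N L (taylor_coef d Th a b tau M) JJ2 L0 big2.
set Q := ((J ^ 2) ^ E0)%N in qE near.
have QJ : Q = (J ^ (2 * E0))%N by rewrite /Q -expnM.
have Q0 : (0 < Q)%N by rewrite QJ expn_gt0 J0.
have Q0r : 0 <= Q%:R :> R by rewrite ler0n.
have q1r : 1 <= q%:R :> R by rewrite ler1n.
pose sig j : R := \sum_(th <- Th) gbin th j * (b th * M%:R `^ th).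
have coefE j : (0 < j)%N -> taylor_coef d Th a b tau M j = shifted_coef d a M j + sig j / M%:R ^+ j.
  by rewrite lt0n /taylor_coef => /negbTE ->; rewrite subr0.
have gbg th j : th \in Th -> (j <= t1)%N -> `|gbin th j| <= g%:R.
  move=> thT jt; apply: (le_trans (gbin_le j (ThS th thT))).
  by rewrite ler_nat /g leq_pexp2l.
have t1D : (t1 <= D1)%N by rewrite /D1; apply: (leq_trans (leqnSn t1)); rewrite leq_pmulr.
(* The shape of the window is chosen for this: [M / L = W], and [W ^ j <= W ^ t1] for [j <= t1]. *)
have QLM j : (j <= t1)%N -> Q%:R / L%:R ^+ j <= (Q * W ^ t1)%:R / M%:R ^+ j :> R.
  move=> jt; rewrite ler_pdivrMr ?exprn_gt0 // mulrAC ler_pdivlMr ?exprn_gt0 //.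
  rewrite -!natrX -!natrM ler_nat ML expnMn mulnA -!mulnA leq_mul2l; apply/orP; right.
  by rewrite leq_mul2r; apply/orP; right; rewrite leq_pexp2l.
have sigle j : (t0 <= j <= t1)%N -> `|sig j| <= (Q * W ^ t1)%:R.
  move=> /andP[j0 jt].
  have jp : (0 < j)%N by apply: leq_trans j0.
  have MMj : M%:R ^+ S / M%:R ^+ j <= W%:R^-1 :> R.
    have SjE : M%:R ^+ j = M%:R ^+ S * M%:R ^+ (j - S) :> R.
      by rewrite -exprD subnKC //; apply: leq_trans j0; rewrite /t0; clear; lia.
    rewrite SjE invfM mulrA divff ?gt_eqF ?exprn_gt0 // mul1r lef_pV2 ?posrE ?exprn_gt0 //.
    have jS : (0 < j - S)%N by rewrite /t0 in j0; move: j0; clear; lia.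
    rewrite -(prednK jS) exprS; apply: (@le_trans _ _ M%:R).
      by rewrite ler_nat ML leq_pmulr.
    by rewrite ler_peMr ?ler0n // exprn_ege1.
  have crude : `|sig j| <= sz%:R * (g%:R * (J%:R * M%:R ^+ S)).
    apply: sum_seq_le => th thT; rewrite !normrM ler_pM // ?gbg // ler_pM ?bJ //.
    by rewrite ger0_norm ?powR_ge0 // MS.
  (* A crude size bound excludes wrap-around, so that the bound modulo 1 becomes the sharper real
     bound [sigle]. *)
  have wrap : `|q%:R * (sig j / M%:R ^+ j)| <= 4^-1.
    rewrite !normrM normr_nat normfV (ger0_norm (exprn_ge0 j (ltW M0r))).
    apply: (@le_trans _ _ (Q%:R * (sz%:R * (g%:R * (J%:R * W%:R^-1))))).
      apply: ler_pM; rewrite ?ler0n ?ler_nat ?mulr_ge0 ?invr_ge0 ?exprn_ge0 ?ler0n //.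
      apply: (@le_trans _ _ (sz%:R * (g%:R * (J%:R * M%:R ^+ S)) / M%:R ^+ j)).
        by rewrite ler_wpM2r // invr_ge0 exprn_ge0 ?ler0n.
      by rewrite -!mulrA !ler_wpM2l ?ler0n.
    rewrite !mulrA ler_pdivrMr // [X in _ <= X]mulrC ler_pdivlMr // -[4]/(4%:R) -!natrM ler_nat.
    apply: (@leq_trans (Q * J ^ sz * J ^ (S.+1 * t1) * J * J ^ 2)%N).
      apply: leq_mul; last exact: (eJ 2).
      by rewrite leq_mul2r; apply/orP; right; rewrite !leq_mul.
    rewrite QJ -!expnD -expnSr -expnD; apply: JE.
    by rewrite /E; clear; lia.
  have Wsmall : Q%:R / L%:R ^+ j <= 4^-1 :> R.
    rewrite ler_pdivrMr ?exprn_gt0 // [X in _ <= X]mulrC ler_pdivlMr // -natrX -[4]/(4%:R) -natrM ler_nat.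
    apply: (@leq_trans (J ^ (2 * E0 + 2))%N).
      by rewrite expnD -QJ leq_mul2l (eJ 2) orbT.
    apply: (leq_trans (JE _ _)); first by rewrite /E; clear; lia.
    rewrite /L -expnM -[X in (X <= _)%N]expn1 leq_pexp2l // muln_gt0 jp andbT.
    by rewrite /t1 /t0.
  have := near j; rewrite jp (leq_trans jt t1D) => /(_ isT).
  rewrite coefE // /shifted_coef big1 ?add0r; last first.
    move=> t _; rewrite bin_small ?mul0n ?mulr0 //.
    by apply: leq_trans (ltn_ord t) _; rewrite /t0 in j0; move: j0; clear; lia.
  move=> nearj.
  have := nearint_norm_le nearj ltac:(lra); rewrite !normrM normr_nat normfV.
  rewrite (ger0_norm (exprn_ge0 j (ltW M0r))) => le.
  have := le_trans le (QLM j jt); rewrite mulrA ler_pM2r ?invr_gt0 ?exprn_gt0 // => le2.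
  by apply: le_trans le2; rewrite ler_peMl.
have bnd th : th \in Th -> `|b th| * M%:R `^ th <= (2 ^ e1)%:R * (Q * W ^ t1)%:R.
  move=> thT; have := He1 th thT (fun th => b th * M%:R `^ th) (Q * W ^ t1)%:R.
  by rewrite normrM (ger0_norm (powR_ge0 _ _)); apply; apply: sigle.
exists q; split.
- by rewrite q1; apply: (leq_trans qE); rewrite QJ leq_pexp2l // /E; clear; lia.
- pose X : R := (Q * W ^ t1)%:R + (Q * (sz * (g * (2 ^ e1 * (Q * W ^ t1)))))%:R.
  have X0 : 0 <= X by rewrite addr_ge0 ?ler0n.
  have desc : forall j, (1 <= j <= d)%N -> nearint (X / M%:R ^+ j) (q%:R * shifted_coef d a M j).
    move=> j /andP[j1 jd].
    have jt : (j <= t1)%N by rewrite /t1 /t0; move: jd; clear; lia.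
    have -> : q%:R * shifted_coef d a M j =
      q%:R * taylor_coef d Th a b tau M j - q%:R * (sig j / M%:R ^+ j).
      by rewrite coefE //; ring.
    rewrite /X mulrDl; apply: nearintB.
      by apply: nearint_le (QLM j jt) (near j _); rewrite j1 (leq_trans jt).
    apply: nearint_small; rewrite !normrM normr_nat normfV (ger0_norm (exprn_ge0 j (ltW M0r))).
    rewrite mulrA ler_wpM2r ?invr_ge0 ?exprn_ge0 ?ler0n // natrM.
    apply: ler_pM; rewrite ?ler0n ?ler_nat // natrM.
    apply: sum_seq_le => th thT; rewrite normrM natrM ler_pM ?gbg //.
    by rewrite normrM (ger0_norm (powR_ge0 _ _)) natrM; apply: bnd.
  move=> t td; have := @shifted_coef_descent R d a q M c X M0 X0 (leqnn _) desc t td.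
  apply: nearint_le; rewrite ler_wpM2r ?invr_ge0 ?exprn_ge0 ?ler0n //.
  rewrite /X -natrD -natrX -natrM ler_nat -/L.
  have -> : (Q * L + Q * (sz * (g * (2 ^ e1 * (Q * L)))) =
     (Q + Q * (sz * (g * (2 ^ e1 * Q)))) * L)%N by ring.
  rewrite mulnA leq_mul2r; apply/orP; right.
  have cJ : (c ^ d <= J ^ ((2 * d + 2) * d))%N.
    rewrite expnM; case: (d) @c => // d' c; rewrite leq_exp2r //.
    apply: leq_exp2_pexp => //; rewrite /c.
    have := expn_bigger d'.+2; rewrite (_ : 2 * d'.+1 + 2 = d'.+1 + (d'.+2).+1)%N; last by clear; lia.
    rewrite (expnD 2 d'.+1) (expnS 2 d'.+2); have : (0 < 2 ^ d'.+1)%N by rewrite expn_gt0.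
    move: (2 ^ d'.+1)%N (2 ^ d'.+2)%N; clear; nia.
  apply: (@leq_trans (J ^ ((2 * d + 2) * d) * (J * (Q * (J ^ sz * (J ^ (S.+1 * t1) * (J ^ e1 * Q))))))%N).
    apply: leq_mul => //; apply: (@leq_trans (2 * (Q * (J ^ sz * (J ^ (S.+1 * t1) * (J ^ e1 * Q)))))%N).
      rewrite mul2n -addnn leq_add //.
        by rewrite leq_pmulr // !muln_gt0 Q0 !expn_gt0 J0.
      by rewrite !leq_mul.
    by rewrite leq_mul2r J2 orbT.
  rewrite QJ -!expnD -expnS -!expnD leq_pexp2l // /E; clear; lia.
- move=> th thT; apply: (le_trans (bnd th thT)); rewrite -natrM ler_nat mulnA leq_mul2r.
  apply/orP; right; rewrite QJ; apply: (@leq_trans (J ^ e1 * J ^ (2 * E0))%N).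
    by rewrite leq_mul2r eJ orbT.
  by rewrite -expnD leq_pexp2l // /E; clear; lia.
Qed.

End MajorArcs.

(** * Simultaneous approximation *)

Section Simultaneous.
Variable R : realType.
Implicit Types (a : nat -> R) (b tau : R -> R) (Th : seq R).

Lemma gform_lin (I : finType) d Th (h : I -> R) (a : I -> nat -> R) (b : I -> R -> R) tau n :
  \sum_i h i * gform d Th (a i) (b i) tau n =
  gform d Th (fun t => \sum_i h i * a i t) (fun th => \sum_i h i * b i th) tau n.
Proof.
rewrite /gform; under eq_bigr => i _ do rewrite mulrDr !mulr_sumr.
rewrite big_split /= exchange_big /= [X in _ + X]exchange_big /=; congr (_ + _).
  by apply: eq_bigr => t _; rewrite mulr_suml; apply: eq_bigr => i _; rewrite mulrA.
by apply: eq_bigr => t _; rewrite mulr_suml; apply: eq_bigr => i _; rewrite mulrA.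
Qed.

(** Restricting to multiples of [x] and dividing by [p] stays within the class of forms, so an
    induction hypothesis applies along [n = x * m]. *)
Lemma gform_scale d Th a b tau (x m : nat) (p : R) : (0 < x)%N -> p != 0 ->
  gform d Th (fun t => a t * x%:R ^+ t / p) (fun th => b th * x%:R `^ th / p)
    (fun th => tau th / x%:R `^ th) m = gform d Th a b tau (x * m) / p.
Proof.
move=> x0 p0; rewrite /gform mulrDl !mulr_suml; congr (_ + _); apply: eq_bigr => t _.
  by rewrite natrM exprMn; ring.
have xt : x%:R `^ t != 0 :> R by rewrite gt_eqF // powR_gt0 // ltr0n.
rewrite natrM powRM ?ler0n //; move: (x%:R `^ t) (m%:R `^ t) xt => X Y X0.
by field; rewrite X0 p0.
Qed.

(** One factor [p] of [n] cancels the division and one factor [q] is the denominator, so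
    [a t * n ^ t / p] is an integer multiple of [q * a t]. The powers are small outright, since each
    [b th] has size at most [J ^ E / W]. *)
Lemma gform_major_near d Th (S : nat) a b tau (J W t1 E q p m n K : nat) :
  {in Th, forall th, 1 <= th <= S%:R} ->
  (0 < W)%N -> (0 < q)%N -> (0 < p)%N -> (0 < m)%N -> n = (q * p * m)%N ->
  (n <= W)%N -> a 0%N = 0 ->
  (forall t, (1 <= t <= d)%N ->
    nearint ((J ^ E * W ^ t1)%:R / (W ^ t1.+1)%:R ^+ t) (q%:R * a t)) ->
  {in Th, forall th, `|b th| * (W ^ t1.+1)%:R `^ th <= (J ^ E * W ^ t1)%:R} ->
  {in Th, forall th, `|tau th| <= K%:R} ->
  nearint ((d.+1 * (J ^ E * n) + size Th * (J ^ E * (n ^ S + K)))%:R / W%:R)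
    (gform d Th a b tau n / p%:R).
Proof.
move=> ThS W0 q0 p0 m0 nE nW a0 neara nearb tauK.
have n0 : (0 < n)%N by rewrite nE !muln_gt0 q0 p0.
have W0r : 0 < W%:R :> R by rewrite ltr0n.
have p0r : 0 < p%:R :> R by rewrite ltr0n.
have p1r : 1 <= p%:R :> R by rewrite ler1n.
have n1r : 1 <= n%:R :> R by rewrite ler1n.
set M := (W ^ t1.+1)%N in neara nearb.
have ML : (M = W ^ t1 * W)%N by rewrite /M expnSr.
have M0 : (0 < M)%N by rewrite expn_gt0 W0.
have M0r : 0 < M%:R :> R by rewrite ltr0n.
have WM : (W <= M)%N by rewrite ML leq_pmull // expn_gt0 W0.
rewrite /gform mulrDl natrD mulrDl; apply: nearintD.
- rewrite mulr_suml.
  have -> : (d.+1 * (J ^ E * n))%:R / W%:R = \sum_(t < d.+1) (J ^ E * n)%:R / W%:R :> R.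
    by rewrite sumr_const card_ord natrM mulr_natl -mulrnAl.
  apply: nearint_sum => -[[|t] td] _ /=.
    rewrite a0 !mul0r; apply: nearint_small; rewrite normr0.
    by rewrite divr_ge0 ?ler0n.
  have -> : a t.+1 * n%:R ^+ t.+1 / p%:R = (q ^ t * p ^ t * m ^ t.+1)%:R * (q%:R * a t.+1).
    rewrite nE !natrM !exprMn !natrX [q%:R ^+ t.+1]exprS [p%:R ^+ t.+1]exprS.
    by field; rewrite gt_eqF.
  apply: nearint_le (nearintMn _ (neara t.+1 td)).
  rewrite mulrA ler_pdivrMr ?exprn_gt0 // mulrAC ler_pdivlMr //.
  rewrite -!natrX -!natrM ler_nat.
  apply: (@leq_trans (n ^ t.+1 * (J ^ E * W ^ t1) * W)%N).
    rewrite !leq_mul2r; apply/orP; right; apply/orP; right.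
    rewrite nE !expnMn leq_mul2r; apply/orP; right; apply: leq_mul; by rewrite expnS leq_pmull.
  rewrite -!mulnA -ML [X in (X <= _)%N]mulnCA leq_mul2l; apply/orP; right.
  rewrite !expnS -mulnA leq_mul2l; apply/orP; right; rewrite mulnC leq_mul2l; apply/orP; right.
  by case: (t) => // t'; rewrite leq_exp2r // (leq_trans nW).
- apply: nearint_small; rewrite normrM normfV normr_nat.
  rewrite natrM -mulrA; apply: (@le_trans _ _ `|\sum_(th <- Th) b th * (n%:R `^ th - tau th)|).
    by rewrite ler_pdivrMr // ler_peMr.
  apply: sum_seq_le => th thT.
  have /andP[th1 thS] := ThS th thT.
  have MM : M%:R <= M%:R `^ th :> R by rewrite le1r_powR // ler1n.
  have bM : `|b th| <= (J ^ E)%:R / W%:R.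
    rewrite ler_pdivlMr // -(ler_pM2r (_ : 0 < (W ^ t1)%:R)); last by rewrite ltr0n expn_gt0 W0.
    rewrite -natrM; apply: le_trans (nearb th thT); rewrite -mulrA -natrM mulnC -ML.
    by rewrite ler_wpM2l.
  rewrite normrM natrM mulrAC; apply: ler_pM => //.
  apply: (le_trans (ler_normB _ _)); rewrite natrD natrX; apply: lerD; last exact: tauK.
  by rewrite ger0_norm ?powR_ge0 // -powR_mulrn ?ler0n // ler_powR.
Qed.

(** If the window contains no solution, a combination of the forms with coefficients [h] is
    controlled. Solving it for form [i0] means dividing by [p], the absolute value of [h i0]; so the
    induction hypothesis is applied to the other forms divided by [p], along multiples of [q * p]
    and at a finer scale [K1]. *)
Lemma simultaneous_approximation d Th (S : nat) : uniq Th ->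
  {in Th, forall th, 1 <= th <= S%:R} -> {in Th, forall th, forall z : int, th != z%:~R} ->
  forall l : nat, exists E : nat,
  forall (K : nat) (a : nat -> nat -> R) (b : nat -> R -> R) (tau : R -> R),
  (2 <= K)%N -> (forall i, a i 0%N = 0) ->
  (forall i, {in Th, forall th, `|b i th| <= K%:R}) ->
  {in Th, forall th, `|tau th| <= K%:R} ->
  exists n, (1 <= n <= K ^ E)%N /\
    forall i, (i < l)%N -> nearint (K%:R^-1) (gform d Th (a i) (b i) tau n).
Proof.
move=> uTh ThS nint; have [t1 [Em major]] := major_arcs d uTh ThS nint.
elim=> [|l [El IH]].
  by exists 0%N => K a b tau K2 _ _ _; exists 1%N.
have [c detect] := detection R l.+1.
pose sz := size Th.
(* The order avoids circularity: [Ek] covers the growth of coefficients under rescaling, [nu] then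
   gives [n <= J ^ nu], and only afterwards does [Ew] make [W] large compared with [n]. *)
pose Ek := ((Em + 1) * S + 2)%N; pose nu := (Em + 1 + Ek * El)%N.
pose Ew := (Em + nu * S.+1 + d + sz + 10)%N.
(* [J] dominates the losses of [detection] and the [l.+1] products that make up a coefficient of the
   combination. *)
pose cJ := (c + l + 3)%N.
exists (cJ * (Ew * t1.+1) + cJ * nu + 1)%N => K a b tau K2 a0 bK tauK.
have K0 : (0 < K)%N by apply: leq_trans K2.
pose J := (K ^ cJ)%N; pose W := (J ^ Ew)%N; pose M := (W ^ t1.+1)%N; pose L := (W ^ t1)%N.
have KJ : (K <= J)%N by rewrite -[X in (X <= _)%N]expn1 leq_pexp2l // /cJ; clear; lia.
have J2 : (2 <= J)%N by apply: leq_trans KJ.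
have J0 : (0 < J)%N by apply: leq_trans J2.
have W0 : (0 < W)%N by rewrite expn_gt0 J0.
have L0 : (0 < L)%N by rewrite expn_gt0 W0.
have M0 : (0 < M)%N by rewrite expn_gt0 W0.
have LM : (L <= M)%N by rewrite /M expnSr leq_pmulr.
have K0r : 0 < K%:R :> R by rewrite ltr0n.
set E := (_ + 1)%N.
have [[m mL near]|no] := pselect (exists2 m, (m < L)%N & forall i, (i < l.+1)%N ->
    nearint (K%:R^-1) (gform d Th (a i) (b i) tau (M + m))).
  exists (M + m)%N; split => //; rewrite addn_gt0 M0 /=.
  apply: (@leq_trans (2 * M)%N); first by move: mL LM; clear; lia.
  apply: (@leq_trans (K * M)%N); first by rewrite leq_mul2r K2 orbT.
  by rewrite /M /W /J -!expnM -expnS leq_pexp2l // /E ?mulnA; clear; lia.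
have far m : (m < L)%N -> exists2 i, (i < l.+1)%N &
    ~ nearint (K%:R^-1) (gform d Th (a i) (b i) tau (M + m)).
  move=> mL; apply: contrapT => H; apply: no; exists m => // i il.
  by apply: contrapT => H'; apply: H; exists i.
have [h [hK [i0 i0l hi0] big]] :=
  detect K L (fun i m => gform d Th (a i) (b i) tau (M + m)) K2 L0 far.
pose A t : R := \sum_(i < l.+1) (h i)%:~R * a i t.
pose B th : R := \sum_(i < l.+1) (h i)%:~R * b i th.
have linE n : \sum_(i < l.+1) (h i)%:~R * gform d Th (a i) (b i) tau n = gform d Th A B tau n.
  exact: (@gform_lin 'I_l.+1 d Th (fun i => (h i)%:~R) a b tau n).
have hKr (i : nat) : (i < l.+1)%N -> `|(h i)%:~R| <= (K ^ c)%:R :> R.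
  by move=> il; rewrite -intr_norm [X in _ <= X]pmulrn ler_int; apply: hK.
have BJ : {in Th, forall th, `|B th| <= J%:R}.
  move=> th thT; apply: (le_trans (ler_norm_sum _ _ _)).
  apply: (@le_trans _ _ (\sum_(i < l.+1) (K ^ c * K)%:R)).
    by apply: ler_sum => i _; rewrite normrM natrM ler_pM // ?hKr // bK.
  rewrite sumr_const card_ord -mulrnA ler_nat mulnC.
  apply: (@leq_trans (K ^ l.+1 * (K ^ c * K))%N).
    by rewrite leq_mul2r; apply/orP; right; apply: leq_exp2_pexp => //; apply: expn_bigger.
  by rewrite -expnSr -expnD leq_pexp2l // /cJ; clear; lia.
have KcJ : (K ^ c <= J)%N by rewrite leq_pexp2l // /cJ; clear; lia.
have JW : (J ^ Em <= W)%N by rewrite leq_pexp2l // /Ew; clear; lia.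
have [] := major J W A B tau J2 JW BJ.
  apply: (@le_trans _ _ ((K ^ c)%:R * `|csum (fun m => gform d Th A B tau (M + m)) L|)).
    have -> : (fun m => gform d Th A B tau (M + m)) =
       (fun m => \sum_(i < l.+1) (h i)%:~R * gform d Th (a i) (b i) tau (M + m)).
      by apply: funext => m; rewrite linE.
    exact: big.
  by rewrite ler_wpM2r // ler_nat.
move=> q [/andP[q1 qJ] nearA nearB].
pose p := `|h i0|%N.
have p1 : (0 < p)%N by rewrite absz_gt0.
have pJ : (p <= K ^ c)%N by have := hK i0 i0l; rewrite /p; clear; lia.
have p0r : 0 < p%:R :> R by rewrite ltr0n.
pose x := (q * p)%N.
have x0 : (0 < x)%N by rewrite muln_gt0 q1.
have xJ : (x <= J ^ (Em + 1))%N.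
  by rewrite expnD expn1 leq_mul // (leq_trans pJ).
pose K1 := (J ^ Ek)%N.
have JK1 : (J ^ 2 <= K1)%N by rewrite leq_pexp2l // /Ek leq_addl.
have K12 : (2 <= K1)%N.
  by apply: (leq_trans J2); apply: leq_trans JK1; rewrite -[X in (X <= _)%N]expn1 leq_pexp2l.
have K1r : 0 < K1%:R :> R by rewrite ltr0n expn_gt0 J0.
have x1r : 1 <= x%:R :> R by rewrite ler1n.
(* [bump i0] enumerates the forms other than [i0]. *)
have [] := IH K1 (fun i t => a (bump i0 i) t * x%:R ^+ t / p%:R)
   (fun i th => b (bump i0 i) th * x%:R `^ th / p%:R) (fun th => tau th / x%:R `^ th) K12.
- by move=> i; rewrite a0 !mul0r.
- move=> i th thT; have /andP[_ thS] := ThS th thT.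
  rewrite !normrM normfV normr_nat ler_pdivrMr //.
  apply: (@le_trans _ _ K1%:R); last by rewrite ler_peMr ?ler0n // ler1n.
  apply: (@le_trans _ _ (K%:R * x%:R ^+ S)).
    apply: ler_pM => //; first exact: bK.
    by rewrite ger0_norm ?powR_ge0 // -powR_mulrn ?ler0n // ler_powR.
  rewrite -natrX -natrM ler_nat; apply: (@leq_trans (J * (J ^ (Em + 1)) ^ S)%N).
    by apply: leq_mul => //; case: (S) => // S'; rewrite leq_exp2r.
  by rewrite -expnM -expnS leq_pexp2l // /Ek; clear; lia.
- move=> th thT; have /andP[th1 _] := ThS th thT.
  rewrite normrM normfV (ger0_norm (powR_ge0 _ _)) ler_pdivrMr ?powR_gt0 ?ltr0n //.
  apply: (le_trans (tauK th thT)); apply: (@le_trans _ _ K1%:R).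
    rewrite ler_nat (leq_trans KJ) // (leq_trans _ JK1) // -[X in (X <= _)%N]expn1.
    by rewrite leq_pexp2l.
  rewrite ler_peMr ?ler0n //; apply: (le_trans x1r).
  by rewrite le1r_powR.
move=> m [/andP[m1 mK] nearm].
pose n := (x * m)%N.
have nJ : (n <= J ^ nu)%N.
  apply: (@leq_trans (J ^ (Em + 1) * K1 ^ El)%N); first by rewrite leq_mul.
  by rewrite /K1 -expnM -expnD.
have n1 : (0 < n)%N by rewrite muln_gt0 x0.
exists n; split.
  rewrite n1; apply: (leq_trans nJ); rewrite /J -expnM leq_pexp2l // /E; clear; lia.
have nearg i : (i < l)%N ->
    nearint (K1%:R^-1) (gform d Th (a (bump i0 i)) (b (bump i0 i)) tau n / p%:R).
  by move=> il; have := nearm i il; rewrite gform_scale // gt_eqF.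
have pK1 : p%:R / K1%:R <= K%:R^-1 :> R.
  rewrite ler_pdivrMr // [X in _ <= X]mulrC ler_pdivlMr // -natrM ler_nat; apply: leq_trans JK1.
  by rewrite expnS expn1 leq_mul // (leq_trans pJ).
have others i : (i < l)%N -> nearint (K%:R^-1) (gform d Th (a (bump i0 i)) (b (bump i0 i)) tau n).
  move=> il; apply: nearint_le pK1 _.
  have := nearintMn p (nearg i il); by rewrite [X in nearint _ X]mulrC divfK ?gt_eqF.
move=> i il; have [->|/eqP ii0] := eqVneq i i0; last first.
  have -> : i = bump i0 (unbump i0 i) by rewrite unbumpK // inE; apply/eqP.
  apply: others; rewrite /unbump; move: il i0l ii0; clear; case: ltnP; lia.
have A0 : A 0%N = 0 by rewrite /A big1 // => j _; rewrite a0 mulr0.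
have nW : (n <= W)%N by apply: (leq_trans nJ); rewrite leq_pexp2l // /Ew; clear; nia.
have GN := @gform_major_near d Th S A B tau J W t1 Em q p m n K ThS W0 q1 p1 m1 erefl nW
   A0 nearA nearB tauK.
have W0r : 0 < W%:R :> R by rewrite ltr0n.
have smallG : (d.+1 * (J ^ Em * n) + size Th * (J ^ Em * (n ^ S + K)))%:R / W%:R <= (2 * K%:R)^-1 :> R.
  rewrite ler_pdivrMr // [X in _ <= X]mulrC ler_pdivlMr ?mulr_gt0 // -[2]/(2%:R) -!natrM ler_nat.
  have h1 : (d.+1 * (J ^ Em * n) <= J ^ (d.+1 + (Em + nu)))%N.
    rewrite (expnD J d.+1) (expnD J Em); apply: leq_mul; first by apply: leq_exp2_pexp => //; apply: expn_bigger.
    by rewrite leq_mul2l nJ orbT.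
  have h2 : (size Th * (J ^ Em * (n ^ S + K)) <= J ^ (sz + (Em + (nu * S + 2))))%N.
    rewrite (expnD J sz); apply: leq_mul; first by apply: leq_exp2_pexp => //; apply: expn_bigger.
    rewrite (expnD J Em) leq_mul2l; apply/orP; right.
    have nS : (n ^ S <= J ^ (nu * S))%N by rewrite expnM; case: (S) => // S'; rewrite leq_exp2r.
    rewrite (expnD J (nu * S)) (expnSr J 1) expn1.
    have X0 : (0 < J ^ (nu * S))%N by rewrite expn_gt0 J0.
    apply: (@leq_trans (J ^ (nu * S) * J + J ^ (nu * S) * J)%N).
      by apply: leq_add; [apply: (leq_trans nS); rewrite leq_pmulr|apply: (leq_trans KJ); rewrite leq_pmull].
    by rewrite addnn -muln2 -mulnA leq_mul2l leq_mul2l J2 !orbT.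
  apply: (@leq_trans ((J ^ (Em + nu * S.+1 + d + sz + 3) * 2) * (2 * K))%N).
    rewrite leq_mul2r; apply/orP; right; rewrite muln2 -addnn; apply: leq_add.
      by apply: (leq_trans h1); rewrite leq_pexp2l // mulnS; clear; lia.
    by apply: (leq_trans h2); rewrite leq_pexp2l // mulnS; clear; lia.
  apply: (@leq_trans ((J ^ (Em + nu * S.+1 + d + sz + 3) * J) * (J * J))%N).
    by rewrite !leq_mul.
  by rewrite -expnSr -(expnSr J 1) -expnD leq_pexp2l // /Ew; clear; lia.
have sumN : nearint (\sum_(j < l) (K ^ c)%:R * K1%:R^-1)
   (\sum_(j < l) (h (bump i0 j))%:~R * (gform d Th (a (bump i0 j)) (b (bump i0 j)) tau n / p%:R)).
  apply: nearint_sum => j _; apply: nearint_le (nearintMz _ (nearg j (ltn_ord j))).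
  rewrite ler_wpM2r ?invr_ge0 ?ler0n // intr_norm; apply: hKr.
  by rewrite /bump; have := ltn_ord j; case: leqP; clear; lia.
have smallS : \sum_(j < l) (K ^ c)%:R * K1%:R^-1 <= (2 * K%:R)^-1 :> R.
  rewrite sumr_const card_ord -[X in X <= _]mulr_natl mulrA ler_pdivrMr // [X in _ <= X]mulrC.
  rewrite ler_pdivlMr ?mulr_gt0 // -[2]/(2%:R) -!natrM ler_nat.
  apply: (@leq_trans J); last first.
    by apply: leq_trans JK1; rewrite -[X in (X <= _)%N]expn1 leq_pexp2l.
  apply: (@leq_trans (K ^ l * K ^ c * (K * K))%N).
    apply: leq_mul; last by rewrite leq_mul2r K2 orbT.
    by rewrite leq_mul2r; apply/orP; right; apply: leq_exp2_pexp => //; apply: expn_bigger.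
  by rewrite -(expnSr K 1) -!expnD leq_pexp2l // /cJ; clear; lia.
have := nearintB GN sumN.
(* Subtracting the other forms from the combination leaves form [i0] times the sign of [h i0]. *)
have -> : gform d Th A B tau n / p%:R -
   \sum_(j < l) (h (bump i0 j))%:~R * (gform d Th (a (bump i0 j)) (b (bump i0 j)) tau n / p%:R)
   = ((h i0)%:~R / p%:R) * gform d Th (a i0) (b i0) tau n.
  rewrite -linE (bigD1_ord (Ordinal i0l)) //= mulrDl mulr_suml.
  under [X in _ + X - _]eq_bigr => j _ do rewrite -mulrA.
  by rewrite addrK; ring.
have halves : (2 * K%:R)^-1 + (2 * K%:R)^-1 = K%:R^-1 :> R by field; rewrite gt_eqF.
move=> near0.
have {}near0 : nearint (K%:R^-1) (((h i0)%:~R / p%:R) * gform d Th (a i0) (b i0) tau n).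
  by apply: nearint_le near0; rewrite -halves lerD.
have pE : (p%:R : R) = `|(h i0)%:~R| by rewrite -intr_norm /p -abszE.
have [hpos|hneg] := leP 0 (h i0).
  move: near0; rewrite pE ger0_norm ?ler0z // divff ?mul1r //.
  by rewrite intr_eq0.
move: near0; rewrite pE ltr0_norm ?ltrz0 // invrN mulrN divff ?intr_eq0 // mulN1r => near0.
by have := nearintN near0; rewrite opprK.
Qed.

End Simultaneous.

(** * Pseudo-polynomials and the removal of floors *)

Section PseudoPolynomials.
Variable R : realType.

Lemma simultaneous_approximation_fin (I : finType) d (Th : seq R) (S : nat) : uniq Th ->
  {in Th, forall th, 1 <= th <= S%:R} -> {in Th, forall th, forall z : int, th != z%:~R} ->
  exists E : nat,
  forall (K : nat) (a : I -> nat -> R) (b : I -> R -> R) (tau : R -> R),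
  (2 <= K)%N -> (forall i, a i 0%N = 0) ->
  (forall i, {in Th, forall th, `|b i th| <= K%:R}) ->
  {in Th, forall th, `|tau th| <= K%:R} ->
  exists n, (1 <= n <= K ^ E)%N /\
    forall i, nearint (K%:R^-1) (gform d Th (a i) (b i) tau n).
Proof.
move=> uTh ThS nint.
have [E HE] := simultaneous_approximation d uTh ThS nint #|I|.
exists E => K a b tau K2 a0 bK tauK.
pose a' (i : nat) := if insub i is Some o then a (enum_val (o : 'I_#|I|)) else fun=> 0.
pose b' (i : nat) := if insub i is Some o then b (enum_val (o : 'I_#|I|)) else fun=> 0.
have [||n [n1 Hn]] := HE K a' b' tau K2 _ _ tauK.
- by move=> i; rewrite /a'; case: insubP.
- move=> i th thT; rewrite /b'; case: insubP => [v _ _|_]; first exact: bK.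
  by rewrite normr0 ler0n.
exists n; split => // i; have := Hn (enum_rank i) (ltn_ord _).
by rewrite /a' /b' valK enum_rankK.
Qed.

Lemma pseudo_poly_terms (f : R -> R) : pseudo_poly f -> exists s : seq (R * R),
  [/\ {in s, forall u, 0 < u.1 /\ 1 <= u.2}, exists2 u, u \in s & u.2 \isn't a Num.int &
    forall x, 0 < x -> f x = \sum_(u <- s) u.1 * x `^ u.2].
Proof.
case=> d [alpha [theta [a0 [t1 [_ [[j nj] fE]]]]]].
exists [seq (alpha i, theta i) | i <- enum 'I_d]; split.
- by move=> u /mapP[i _ ->]; split; [apply: a0 | apply: t1].
- exists (alpha j, theta j); first by apply: map_f; rewrite mem_enum.
  by apply/negP => /intrP[z E]; apply: nj; exists z.
- by move=> x x0; rewrite fE // big_map big_enum.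
Qed.

Lemma intr_natr_between (x : R) (S : nat) : x \is a Num.int -> 1 <= x <= S%:R ->
  exists2 t : nat, x = t%:R & (1 <= t <= S)%N.
Proof.
move=> /intrP[z ->] /andP[z1 zS].
have z1' : 1 <= z by move: z1; rewrite -[1]/(1%:~R) ler_int.
exists `|z|%N; first by rewrite pmulrn gez0_abs // (le_trans _ z1').
have zS' : z <= S%:Z by move: zS; rewrite [X in _ <= X]pmulrn ler_int.
by move: z1' zS'; clear; lia.
Qed.

(** Each term goes to the polynomial part or to [Th] according to whether its exponent is an
    integer; the common shift [tau] then subtracts [tau] times the sum of the non-integral
    coefficients. *)
Lemma pseudo_poly_gform (s : seq (R * R)) (Th : seq R) (S n : nat) (tau : R) :
  uniq Th -> {in Th, forall th, th \isn't a Num.int} ->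
  {in s, forall u, 1 <= u.2 <= S%:R} ->
  {in s, forall u, u.2 \isn't a Num.int -> u.2 \in Th} -> (0 < n)%N ->
  gform S Th (fun t => \sum_(u <- s | u.2 == t%:R) u.1)
    (fun th => \sum_(u <- s | u.2 == th) u.1) (fun=> tau) n =
  \sum_(u <- s) u.1 * n%:R `^ u.2 - tau * \sum_(th <- Th) \sum_(u <- s | u.2 == th) u.1.
Proof.
move=> uTh Thn us usT n0.
rewrite /gform mulr_sumr.
under [X in _ + X]eq_bigr => th _ do rewrite mulrBr [X in _ - X]mulrC.
rewrite sumrB addrA; congr (_ - _).
have -> : \sum_(t < S.+1) (\sum_(u <- s | u.2 == t%:R) u.1) * n%:R ^+ t =
   \sum_(u <- s) \sum_(t < S.+1) (if u.2 == t%:R then u.1 * n%:R ^+ t else 0).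
  rewrite [RHS]exchange_big /=; apply: eq_bigr => t _.
  by rewrite mulr_suml [LHS]big_mkcond.
have -> : \sum_(th <- Th) (\sum_(u <- s | u.2 == th) u.1) * n%:R `^ th =
   \sum_(u <- s) \sum_(th <- Th) (if u.2 == th then u.1 * n%:R `^ th else 0).
  rewrite [RHS]exchange_big /=; apply: eq_bigr => th _.
  by rewrite mulr_suml [LHS]big_mkcond.
rewrite -big_split /= [LHS]big_seq [RHS]big_seq; apply: eq_bigr => u uin.
have [uint|unint] := boolP (u.2 \is a Num.int).
  have [t tE /andP[t1 tS]] := intr_natr_between uint (us u uin).
  rewrite [X in _ + X]big_seq [X in _ + X]big1 ?addr0; last first.
    by move=> th /Thn; case: eqP => // <-; rewrite uint.
  rewrite (bigD1 (Ordinal (tS : (t < S.+1)%N))) //= tE eqxx big1 ?addr0.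
    by rewrite powR_mulrn ?ler0n.
  move=> i /eqP ni; case: eqP => // /eqP; rewrite eqr_nat => /eqP E; case: ni.
  by apply: val_inj.
rewrite [X in X + _]big1 ?add0r; last first.
  by move=> t _; case: eqP => // E; move: unint; rewrite E natr_int.
rewrite (bigD1_seq u.2) ?usT //= eqxx big1 ?addr0 // => th /negbTE.
by rewrite eq_sym => ->.
Qed.

Lemma dist_int_le (eps x : R) : nearint eps x -> dist_int x <= eps.
Proof.
move=> [z Hz]; rewrite /dist_int ge_min.
have [zf|zf] := leP z (Num.floor x).
  apply/orP; left; apply: le_trans (le_trans (ler_norm _) Hz).
  by rewrite lerD2l lerN2 ler_int.
apply/orP; right; apply: le_trans (le_trans (ler_norm _) _).
  apply: (_ : _ <= z%:~R - x); rewrite lerD2r ler_int; move: zf; clear; lia.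
by rewrite distrC.
Qed.

Lemma fin_exp2_bound (I : finType) (F : I -> R) : exists e : nat, forall i, F i <= (2 ^ e)%:R.
Proof.
have [e He] : exists e, {in enum I, forall i, F i <= (2 ^ e)%:R}.
  apply: (seq_bound (P := fun i e => F i <= (2 ^ e)%:R)).
    by move=> i _; apply: exists_exp2_ge.
  by move=> i e e' le; move/le_trans; apply; rewrite ler_pexpK.
by exists e => i; apply: He; rewrite mem_enum.
Qed.

End PseudoPolynomials.

Theorem theorem2p11 (R : realType) (l k : nat) (f : 'I_k -> R -> R) :
  (0 < l)%N ->
  (forall j, pseudo_poly (f j)) ->
  Q_lin_indep f ->
  exists eta : R, 0 < eta /\
  exists C : R, 0 < C /\
  forall (A : 'M[R]_(l, k)) (N : nat), (1 <= N)%N ->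
    exists n : nat, (1 <= n <= N)%N /\
      forall i : 'I_l,
        dist_int (\sum_(j < k) A i j * (Num.floor (f j n%:R))%:~R)
          <= C * powR N%:R (- eta).
Proof.
move=> _ pf _.
have [s Hs] := fin_all_exists (fun j => pseudo_poly_terms (pf j)).
pose all_terms := flatten [seq s j | j <- enum 'I_k].
have sub j u : u \in s j -> u \in all_terms.
  by move=> us; apply/flatten_mapP; exists j; rewrite ?mem_enum.
(* The non-integral exponents of all the [f j] are pooled, so that one list serves every form. *)
pose Th := undup [seq u.2 | u <- all_terms & u.2 \isn't a Num.int].
have uTh : uniq Th by apply: undup_uniq.
have Thn : {in Th, forall th, th \isn't a Num.int}.
  by move=> th; rewrite mem_undup => /mapP[u]; rewrite mem_filter => /andP[? _] ->.
have sTh j : {in s j, forall u, u.2 \isn't a Num.int -> u.2 \in Th}.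
  move=> u us un; rewrite mem_undup; apply/mapP; exists u => //.
  by rewrite mem_filter un (sub j).
have [S HS] : exists S, {in all_terms, forall u, u.2 <= S%:R}.
  apply: (seq_bound (P := fun u S => u.2 <= S%:R)).
    move=> u _; have [e He] := exists_exp2_ge u.2; by exists (2 ^ e)%N.
  by move=> u e e' le; move/le_trans; apply; rewrite ler_nat.
have sS j : {in s j, forall u, 1 <= u.2 <= S%:R}.
  move=> u us; have [pos _ _] := Hs j; have [_ ->] := pos u us.
  by apply: HS; apply: sub us.
have ThS : {in Th, forall th, 1 <= th <= S%:R}.
  move=> th; rewrite mem_undup => /mapP[u]; rewrite mem_filter => /andP[_ /flatten_mapP[j _ us]] ->.
  exact: sS us.
have nint : {in Th, forall th, forall z : int, th != z%:~R}.
  by move=> th /Thn /negP nz z; apply/eqP => E; apply: nz; rewrite E intr_int.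
pose a (j : 'I_k) (t : nat) : R := \sum_(u <- s j | u.2 == t%:R) u.1.
pose b (j : 'I_k) (th : R) : R := \sum_(u <- s j | u.2 == th) u.1.
pose sigma j : R := \sum_(th <- Th) b j th.
have b_ge0 j th : 0 <= b j th.
  rewrite /b big_seq_cond; apply: sumr_ge0 => u /andP[us _].
  by have [pos _ _] := Hs j; have [/ltW] := pos u us.
(* Positive coefficients and one non-integral exponent: a positive shift [tau] of the powers lowers
   every [f j], by [tau * sigma j]. *)
have sigma_gt0 j : 0 < sigma j.
  have [pos [u us un] _] := Hs j.
  rewrite /sigma (bigD1_seq u.2 (sTh j u us un) uTh) /=.
  apply: ltr_pwDl; last by apply: sumr_ge0.
  rewrite /b (big_rem u us) /= eqxx; have [u0 _] := pos u us.
  apply: ltr_pwDl => //; rewrite big_seq_cond; apply: sumr_ge0 => v /andP[/mem_rem vs _].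
  by have [/ltW] := pos v vs.
have a0 j : a j 0%N = 0.
  rewrite /a big_seq_cond big1 // => u /andP[us /eqP u0].
  by have := sS j u us; rewrite u0; lra.
have gE j tau n : (0 < n)%N -> gform S Th (a j) (b j) (fun=> tau) n = f j n%:R - tau * sigma j.
  move=> n0; rewrite /sigma /a /b (pseudo_poly_gform tau uTh Thn (sS j) (sTh j) n0).
  by have [_ _ ->] := Hs j; rewrite ?ltr0n.
have [e1 He1] := fin_exp2_bound (fun j => (sigma j)^-1).
have [e2 He2] := fin_exp2_bound sigma.
have [e3 He3] : exists e, {in Th, forall th, \sum_j b j th <= (2 ^ e)%:R}.
  apply: (seq_bound (P := fun th e => \sum_j b j th <= (2 ^ e)%:R)).
    by move=> th _; apply: exists_exp2_ge.
  by move=> th e e' le; move/le_trans; apply; rewrite ler_pexpK.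
(* Index [inl j] stands for [f j] itself, used to locate its floor, and [inr i] for the combination
   from row [i] of the matrix. *)
have [E HE] := @simultaneous_approximation_fin R ('I_k + 'I_l)%type S Th S uTh ThS nint.
pose K0 := (2 ^ (e1 + e2 + e3 + 2))%N.
(* With [K] the integer part of [N ^ eta], this gives [K ^ E <= N]; the successor avoids division by
   zero when [E = 0]. *)
pose eta : R := E.+1%:R^-1.
have eta0 : 0 < eta by rewrite invr_gt0 ltr0n.
exists eta; split => //.
exists (2 * k.+1%:R + K0%:R); split; first by rewrite ltr_pwDl ?ler0n // mulr_gt0 ?ltr0n.
move=> A N N1.
have N1r : 1 <= N%:R :> R by rewrite ler1n.
pose y : R := N%:R `^ eta.
have y1 : 1 <= y by rewrite -(powRr0 N%:R) ler_powR // ltW.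
have y0 : 0 < y by lra.
have yE : y ^+ E.+1 = N%:R.
  by rewrite -powR_mulrn ?ltW // -powRrM mulVf ?pnatr_eq0 // powRr1 // ler0n.
rewrite powRN -/y.
pose K := Num.truncn y.
have [Ky yK] : K%:R <= y /\ y < K.+1%:R by have /andP[] := truncn_itv (ltW y0).
(* Below the threshold the trivial bound 1 suffices, since [y < K + 1 <= K0] is absorbed by the
   constant. *)
have [small|large] := ltnP K K0.
  exists 1%N; rewrite N1; split => // i.
  apply: (@le_trans _ _ 1); first by apply: dist_int_le; apply: nearint1.
  rewrite ler_pdivlMr // mul1r; apply: (le_trans (ltW yK)).
  by rewrite (le_trans (y := K0%:R)) ?ler_nat // lerDr mulr_ge0 ?ler0n.
have K04 : (4 <= K)%N.
  by apply: leq_trans large; rewrite /K0 -[4%N]/(2 ^ 2)%N leq_exp2l // leq_addl.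
have K0r : 0 < K%:R :> R by rewrite ltr0n; apply: leq_trans K04.
have Kexp e : (e <= e1 + e2 + e3 + 2)%N -> (2 ^ e)%:R <= K%:R :> R.
  by move=> le; rewrite ler_nat; apply: leq_trans large; rewrite leq_exp2l.
(* As [2 ^ e1] is at least every [1 / sigma j], the shift [tau * sigma j] is at least [1 / K]; it is
   at most 1/4 because [K0 <= K]. *)
pose tau : R := (2 ^ e1)%:R / K%:R.
(* Floors are integers, so passing to fractional parts changes the sums by integers only; entries in
   [[0, 1]] make the bounds uniform in [A]. *)
pose fr i j : R := A i j - (Num.floor (A i j))%:~R.
have fr01 i j : 0 <= fr i j <= 1.
  have /andP[] := floor_itv (A i j); rewrite intrD /fr; lra.
have [||||n [/andP[n1 nK] near]] := HE K
   (fun x t => match x with inl j => a j t | inr i => \sum_j fr i j * a j t end)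
   (fun x th => match x with inl j => b j th | inr i => \sum_j fr i j * b j th end)
   (fun=> tau).
- by apply: leq_trans K04.
- by move=> [j|i] //; rewrite big1 // => j _; rewrite a0 mulr0.
- have bsum th : th \in Th -> \sum_j b j th <= K%:R.
    move=> thT; apply: (le_trans (He3 th thT)); apply: Kexp; clear; lia.
  move=> [j|i] th thT; apply: le_trans (bsum th thT).
    rewrite ger0_norm // (bigD1 j) //= lerDl; exact: sumr_ge0.
  apply: (le_trans (ler_norm_sum _ _ _)); apply: ler_sum => j _.
  have /andP[fr0 fr1] := fr01 i j.
  by rewrite normrM !ger0_norm // ler_piMl.
- move=> th _; rewrite ger0_norm ?divr_ge0 ?ler0n // ler_pdivrMr //.
  apply: (@le_trans _ _ K%:R); first by apply: Kexp; clear; lia.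
  by rewrite ler_peMr ?ler0n // ler1n; apply: leq_trans K04.
exists n; split.
  rewrite n1 /= -(ler_nat R) -yE; apply: (@le_trans _ _ (K%:R ^+ E.+1)).
    rewrite -natrX ler_nat; apply: (leq_trans nK); rewrite leq_exp2l //.
    by apply: leq_trans K04.
  by rewrite lerXn2r // nnegrE ?ler0n // ltW.
have floorE j : `|f j n%:R - tau * sigma j - (Num.floor (f j n%:R))%:~R| <= K%:R^-1.
  have [z Hz] := near (inl j); move: Hz; rewrite gE // => Hz.
  (* The difference [f j n - z] lies between [tau * sigma j - 1 / K >= 0] and [1/4 + 1/4], so [z] is
     the floor. *)
  suff -> : Num.floor (f j n%:R) = z by [].
  apply: floor_def; rewrite intrD.
  have lo : K%:R^-1 <= tau * sigma j.
    rewrite /tau mulrAC ler_pdivlMr // mulVf ?gt_eqF //.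
    by rewrite -ler_pdivrMr // mul1r.
  have hi : tau * sigma j <= 4^-1.
    rewrite /tau mulrAC ler_pdivrMr // [X in _ <= X]mulrC ler_pdivlMr //.
    apply: (@le_trans _ _ ((2 ^ e1)%:R * (2 ^ e2)%:R * (2 ^ 2)%:R)).
      by rewrite -[4]/((2 ^ 2)%:R) ler_wpM2r ?ler0n // ler_wpM2l ?ler0n.
    by rewrite -!natrM -!expnD; apply: Kexp; clear; lia.
  have K4 : K%:R^-1 <= 4^-1 :> R.
    by rewrite lef_pV2 ?posrE // -[4]/(4%:R) ler_nat.
  by move: Hz; rewrite ler_norml => /andP[]; lra.
move=> i.
have nearA : nearint (k.+1%:R / K%:R) (\sum_(j < k) A i j * (Num.floor (f j n%:R))%:~R).
  (* One [1 / K] comes from the form [inr i], and [k] more from replacing the shifted values by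
     floors, with weights at most 1. *)
  have nearfr : nearint (k.+1%:R / K%:R) (\sum_(j < k) fr i j * (Num.floor (f j n%:R))%:~R).
    have := near (inr i); rewrite -(@gform_lin R 'I_k S Th (fr i) a b) => near0.
    have -> : \sum_(j < k) fr i j * (Num.floor (f j n%:R))%:~R =
       \sum_j fr i j * gform S Th (a j) (b j) (fun=> tau) n -
       \sum_(j < k) fr i j * (f j n%:R - tau * sigma j - (Num.floor (f j n%:R))%:~R).
      by rewrite -sumrB; apply: eq_bigr => j _; rewrite gE //; ring.
    rewrite -natr1 addrC mulrDl mul1r; apply: nearintB => //.
    apply: nearint_small; apply: (le_trans (ler_norm_sum _ _ _)).
    have -> : k%:R / K%:R = \sum_(j < k) K%:R^-1 :> R.
      by rewrite sumr_const card_ord mulr_natl.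
    apply: ler_sum => j _; have /andP[fr0 fr1] := fr01 i j.
    rewrite normrM (ger0_norm fr0); apply: le_trans (floorE j).
    by rewrite ler_piMl.
  have [z Hz] := nearfr.
  exists (z + \sum_(j < k) Num.floor (A i j) * Num.floor (f j n%:R)).
  move: Hz; congr (`|_| <= _).
  have -> : \sum_(j < k) A i j * (Num.floor (f j n%:R))%:~R =
     \sum_(j < k) fr i j * (Num.floor (f j n%:R))%:~R +
     (\sum_(j < k) Num.floor (A i j) * Num.floor (f j n%:R))%:~R.
    rewrite raddf_sum -big_split /=; apply: eq_bigr => j _.
    by rewrite intrM /fr; ring.
  by rewrite intrD; ring.
apply: (le_trans (dist_int_le nearA)).
rewrite ler_pdivlMr // mulrAC ler_pdivrMr //.
(* The factor 2 lost between [y] and its integer part is the one in the constant. *)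
have y2K : y <= 2 * K%:R.
  apply: (le_trans (ltW yK)); rewrite -[2]/(2%:R) -natrM ler_nat.
  by move: K04; clear; lia.
apply: (@le_trans _ _ (k.+1%:R * (2 * K%:R))); first by rewrite ler_wpM2l ?ler0n.
by rewrite mulrA [X in X * _]mulrC ler_wpM2r ?ler0n // lerDl ler0n.
Qed.
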